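(* Let $T$ be a 2-monad on a 2-category $\mathcal K$ satisfying Property L and let $J:T\text{-Alg}_s\to T\text{-Alg}_l$ be the inclusion. Let $\mathcal L$ be a 2-category and let $G:T\text{-Alg}_l\to\mathcal L$ and $H:\mathcal L\to T\text{-Alg}_s$ be 2-functors such that $H$ is left 2-adjoint to $G\circ J:T\text{-Alg}_s\to\mathcal L$. Then there is an induced colax adjunction in which $J\circ H:\mathcal L\to T\text{-Alg}_l$ is left colax adjoint to $G:T\text{-Alg}_l\to\mathcal L$. Moreover, for every $L\in\mathcal L$, the $T$-algebra $HL$ is lax-flexible.
   Context: For a 2-monad $T$ on $\mathcal K$, $T\text{-Alg}_s$ and $T\text{-Alg}_l$ are the 2-categories of strict $T$-algebras, strict (resp. lax) $T$-morphisms, and algebra 2-cells. Property L: the inclusion $J:T\text{-Alg}_s\to T\text{-Alg}_l$ has a left 2-adjoint, and the 2-comonad $Q_l$ on $T\text{-Alg}_s$ generated by this 2-adjunction (the lax morphism classifier 2-comonad) is lax-idempotent. A 2-comonad $(Q,\delta,q)$ (comultiplication $\delta:Q\Rightarrow Q^2$, counit $q:Q\Rightarrow 1$) is lax-idempotent if $\delta_A\dashv q_{QA}$ with identity unit for all $A$ (equivalently, it is a lax-idempotent 2-monad on the 2-category with 1-cells and 2-cells reversed). A $T$-algebra is lax-flexible if it admits a normal pseudo-$Q_l$-coalgebra structure, i.e. a pseudo-$Q_l$-coalgebra structure whose counit coherence isomorphism is an identity. Colax adjunctions. For a pseudofunctor $K$ the structure isomorphisms are $\gamma:K(gf)\Rightarrow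 Kg\circ Kf$ and $\iota:K1_A\Rightarrow 1_{KA}$. A colax natural transformation $\alpha:K\Rightarrow K'$ consists of 1-cells $\alpha_A:KA\to K'A$ and 2-cells $\alpha_f:\alpha_B\circ Kf\Rightarrow K'f\circ\alpha_A$ for $f:A\to B$, subject to the usual unit, composition and local naturality axioms. A colax adjunction exhibiting $F:\mathcal X\to\mathcal Y$ as left colax adjoint to $U:\mathcal Y\to\mathcal X$ consists of pseudofunctors $F,U$, colax natural transformations $\eta:1_{\mathcal X}\Rightarrow UF$, $\epsilon:FU\Rightarrow 1_{\mathcal Y}$ and modifications $\Psi:\epsilon F\circ F\eta\to 1_F$, $\Phi:1_U\to U\epsilon\circ\eta U$ such that for all $A\in\mathcal X$, $B\in\mathcal Y$ the following composites are identities: $$\eta_A\xrightarrow{\Phi_{FA}\eta_A}U\epsilon_{FA}\,\eta_{UFA}\,\eta_A\xrightarrow{U\epsilon_{FA}\,\eta_{\eta_A}}U\epsilon_{FA}\,UF\eta_A\,\eta_A\xrightarrow{(U\Psi)_A\eta_A}\eta_A,$$ $$\epsilon_B\xrightarrow{\epsilon_B(F\Phi)_B}\epsilon_B\,FU\epsilon_B\,F\eta_{UB}\xrightarrow{\epsilon_{\epsilon_B}F\eta_{UB}}\epsilon_B\,\epsilon_{FUB}\,F\eta_{UB}\xrightarrow{\epsilon_B\Psi_{UB}}\epsilon_B,$$ where $(U\Psi)_A=\iota\circ U\Psi_A\circ\gamma^{-1}$ and $(F\Phi)_B=\gamma\circ F\Phi_B\circ\iota^{-1}$. *)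

(* Defs.v *)
From Stdlib Require Import ProofIrrelevance.

Set Implicit Arguments.
Unset Strict Implicit.
Unset Printing Implicit Defensive.
Set Primitive Projections.

(** * 2-categories *)

Record TwoCatData : Type := MkTwoCatData {
  Ob :> Type;
  Hom : Ob -> Ob -> Type;
  Cell : forall A B : Ob, Hom A B -> Hom A B -> Type;
  id1 : forall A : Ob, Hom A A;
  comp1 : forall A B C : Ob, Hom B C -> Hom A B -> Hom A C;
  id2 : forall (A B : Ob) (f : Hom A B), Cell f f;
  vcomp : forall (A B : Ob) (f g h : Hom A B), Cell g h -> Cell f g -> Cell f h;
  lwhisk : forall (A B C : Ob) (k : Hom B C) (f g : Hom A B),
      Cell f g -> Cell (comp1 k f) (comp1 k g);
  rwhisk : forall (A B C : Ob) (g h : Hom B C) (_ : Cell g h) (f : Hom A B),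
      Cell (comp1 g f) (comp1 h f)
}.

Arguments Hom {_} A B.
Arguments Cell {_ A B} f g.
Arguments id1 {_} A.
Arguments comp1 {_ A B C} g f.
Arguments id2 {_ A B} f.
Arguments vcomp {_ A B f g h} b a.
Arguments lwhisk {_ A B C} k {f g} a.
Arguments rwhisk {_ A B C g h} a f.

Notation "g ∘ f" := (comp1 g f) (at level 40, left associativity).
Notation "β • α" := (vcomp β α) (at level 48, left associativity).
Notation "k ◁ α" := (lwhisk k α) (at level 44, right associativity).
Notation "α ▷ f" := (rwhisk α f) (at level 43, left associativity).

(* Composites of 1-cells in a 2-category agree only up to propositional
   equality, so 2-cells are compared together with their boundaries. *)
Definition tot (C : TwoCatData) (A B : C) (f g : Hom A B) (α : Cell f g) :
    {p : Hom A B * Hom A B & Cell (fst p) (snd p)} :=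
  existT (fun p => Cell (fst p) (snd p)) (f, g) α.

Notation "α ≡ β" := (tot α = tot β) (at level 70, no associativity).

Record TwoCat : Type := MkTwoCat {
  tc_data :> TwoCatData;
  comp1A : forall (A B C D : tc_data) (h : Hom C D) (g : Hom B C) (f : Hom A B),
      h ∘ g ∘ f = h ∘ (g ∘ f);
  comp1_idl : forall (A B : tc_data) (f : Hom A B), id1 B ∘ f = f;
  comp1_idr : forall (A B : tc_data) (f : Hom A B), f ∘ id1 A = f;
  vcompA : forall (A B : tc_data) (f g h k : Hom A B)
      (γ : Cell h k) (β : Cell g h) (α : Cell f g), γ • β • α = γ • (β • α);
  vcomp_idl : forall (A B : tc_data) (f g : Hom A B) (α : Cell f g), id2 g • α = α;
  vcomp_idr : forall (A B : tc_data) (f g : Hom A B) (α : Cell f g), α • id2 f = α;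
  lwhisk_id2 : forall (A B C : tc_data) (k : Hom B C) (f : Hom A B),
      k ◁ id2 f = id2 (k ∘ f);
  rwhisk_id2 : forall (A B C : tc_data) (g : Hom B C) (f : Hom A B),
      id2 g ▷ f = id2 (g ∘ f);
  lwhisk_vcomp : forall (A B C : tc_data) (k : Hom B C) (f g h : Hom A B)
      (β : Cell g h) (α : Cell f g), k ◁ (β • α) = (k ◁ β) • (k ◁ α);
  rwhisk_vcomp : forall (A B C : tc_data) (f g h : Hom B C)
      (β : Cell g h) (α : Cell f g) (k : Hom A B), (β • α) ▷ k = (β ▷ k) • (α ▷ k);
  interchange : forall (A B C : tc_data) (g g' : Hom B C) (f f' : Hom A B)
      (β : Cell g g') (α : Cell f f'), (β ▷ f') • (g ◁ α) = (g' ◁ α) • (β ▷ f);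
  lwhisk_comp1 : forall (A B C D : tc_data) (h : Hom C D) (k : Hom B C) (f g : Hom A B)
      (α : Cell f g), (h ∘ k) ◁ α ≡ h ◁ (k ◁ α);
  rwhisk_comp1 : forall (A B C D : tc_data) (g h : Hom C D) (α : Cell g h)
      (k : Hom B C) (f : Hom A B), α ▷ (k ∘ f) ≡ α ▷ k ▷ f;
  whiskA : forall (A B C D : tc_data) (h : Hom C D) (f g : Hom B C) (α : Cell f g)
      (k : Hom A B), (h ◁ α) ▷ k ≡ h ◁ (α ▷ k);
  lwhisk_id1 : forall (A B : tc_data) (f g : Hom A B) (α : Cell f g), id1 B ◁ α ≡ α;
  rwhisk_id1 : forall (A B : tc_data) (f g : Hom A B) (α : Cell f g), α ▷ id1 A ≡ α
}.

Definition eq2 (C : TwoCatData) (A B : C) (f g : Hom A B) (e : f = g) : Cell f g :=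
  match e in _ = g return Cell f g with eq_refl => id2 f end.

(* Vertical composition of 2-cells whose common boundary agrees up to [e];
   every pasting composite below is written with it, and the choice of [e] is
   immaterial by proof irrelevance. *)
Definition pcomp (C : TwoCatData) (A B : C) (f g g' h : Hom A B)
    (β : Cell g' h) (α : Cell f g) (e : g = g') : Cell f h :=
  β • (eq2 e • α).

Ltac strict := cbn; rewrite ?comp1A, ?comp1_idl, ?comp1_idr; reflexivity.

Notation "β ⊙ α" := (pcomp β α ltac:(strict))
  (at level 48, left associativity, only parsing).
Notation "β ⊙ α" := (pcomp β α _)
  (at level 48, left associativity, only printing).

Record InvCell (C : TwoCatData) (A B : C) (f g : Hom A B) : Type := MkInvCell {
  fwd :> Cell f g;
  inv : Cell g f;
  fwd_inv : fwd • inv = id2 g;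
  inv_fwd : inv • fwd = id2 f
}.
Arguments MkInvCell {C A B f g} fwd inv _ _.

Record InternalAdjunction (C : TwoCat) (A B : C) (l : Hom A B) (r : Hom B A) : Type := {
  adj_unit : Cell (id1 A) (r ∘ l);
  adj_counit : Cell (l ∘ r) (id1 B);
  adj_triangle_l : (adj_counit ▷ l) ⊙ (l ◁ adj_unit) ≡ id2 l;
  adj_triangle_r : (r ◁ adj_counit) ⊙ (adj_unit ▷ r) ≡ id2 r
}.

(** * Pseudofunctors and 2-functors *)

Record PreFunctor (C D : TwoCatData) : Type := MkPreFunctor {
  map0 :> C -> D;
  map1 : forall A B : C, Hom A B -> Hom (map0 A) (map0 B);
  map2 : forall (A B : C) (f g : Hom A B), Cell f g -> Cell (map1 f) (map1 g)
}.
Arguments map1 {C D} F {A B} f : rename.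
Arguments map2 {C D} F {A B f g} α : rename.

Definition pre_id (C : TwoCatData) : PreFunctor C C :=
  {| map0 := fun A => A; map1 := fun A B f => f; map2 := fun A B f g α => α |}.

Definition pre_comp (C D E : TwoCatData) (G : PreFunctor D E) (F : PreFunctor C D) :
    PreFunctor C E :=
  {| map0 := fun A => G (F A);
     map1 := fun A B f => map1 G (map1 F f);
     map2 := fun A B f g α => map2 G (map2 F α) |}.

Record PseudoFunctor (C D : TwoCat) : Type := MkPseudoFunctor {
  pf_map :> PreFunctor C D;
  pf_id2 : forall (A B : C) (f : Hom A B), map2 pf_map (id2 f) = id2 (map1 pf_map f);
  pf_vcomp : forall (A B : C) (f g h : Hom A B) (β : Cell g h) (α : Cell f g),
      map2 pf_map (β • α) = map2 pf_map β • map2 pf_map α;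
  pf_gamma : forall (X Y Z : C) (g : Hom Y Z) (f : Hom X Y),
      InvCell (map1 pf_map (g ∘ f)) (map1 pf_map g ∘ map1 pf_map f);
  pf_iota : forall X : C, InvCell (map1 pf_map (id1 X)) (id1 (pf_map X));
  pf_gamma_natl : forall (X Y Z : C) (g : Hom Y Z) (f f' : Hom X Y) (α : Cell f f'),
      pf_gamma g f' • map2 pf_map (g ◁ α) =
      (map1 pf_map g ◁ map2 pf_map α) • pf_gamma g f;
  pf_gamma_natr : forall (X Y Z : C) (g g' : Hom Y Z) (β : Cell g g') (f : Hom X Y),
      pf_gamma g' f • map2 pf_map (β ▷ f) =
      (map2 pf_map β ▷ map1 pf_map f) • pf_gamma g f;
  pf_gammaA : forall (W X Y Z : C) (h : Hom Y Z) (g : Hom X Y) (f : Hom W X),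
      (map1 pf_map h ◁ pf_gamma g f) • pf_gamma h (g ∘ f) ≡
      (pf_gamma h g ▷ map1 pf_map f) • pf_gamma (h ∘ g) f;
  pf_iotal : forall (X Y : C) (f : Hom X Y),
      (pf_iota Y ▷ map1 pf_map f) • pf_gamma (id1 Y) f ≡ id2 (map1 pf_map f);
  pf_iotar : forall (X Y : C) (f : Hom X Y),
      (map1 pf_map f ◁ pf_iota X) • pf_gamma f (id1 X) ≡ id2 (map1 pf_map f)
}.

Record TwoFunctor (C D : TwoCat) : Type := MkTwoFunctor {
  tf_map :> PreFunctor C D;
  tf_id1 : forall A : C, map1 tf_map (id1 A) = id1 (tf_map A);
  tf_comp1 : forall (X Y Z : C) (g : Hom Y Z) (f : Hom X Y),
      map1 tf_map (g ∘ f) = map1 tf_map g ∘ map1 tf_map f;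
  tf_id2 : forall (A B : C) (f : Hom A B), map2 tf_map (id2 f) = id2 (map1 tf_map f);
  tf_vcomp : forall (A B : C) (f g h : Hom A B) (β : Cell g h) (α : Cell f g),
      map2 tf_map (β • α) = map2 tf_map β • map2 tf_map α;
  tf_lwhisk : forall (X Y Z : C) (k : Hom Y Z) (f g : Hom X Y) (α : Cell f g),
      map2 tf_map (k ◁ α) ≡ map1 tf_map k ◁ map2 tf_map α;
  tf_rwhisk : forall (X Y Z : C) (g h : Hom Y Z) (α : Cell g h) (k : Hom X Y),
      map2 tf_map (α ▷ k) ≡ map2 tf_map α ▷ map1 tf_map k
}.

(** * Reasoning up to [≡] *)

Section Heterogeneous.
Context {C : TwoCat}.

Lemma tot_inj (A B : C) (f g : Hom A B) (α β : Cell f g) : α ≡ β -> α = β.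
Proof. intros E. exact (inj_pair2 _ _ _ _ _ E). Qed.

Lemma tot_ind (A B : C) (f g : Hom A B) (α : Cell f g)
    (P : forall f' g' : Hom A B, Cell f' g' -> Prop) :
  P f g α -> forall f' g' (β : Cell f' g'), α ≡ β -> P f' g' β.
Proof.
intros H f' g' β E.
change (P (fst (projT1 (tot β))) (snd (projT1 (tot β))) (projT2 (tot β))).
rewrite <- E. exact H.
Qed.

Lemma tot_dom (A B : C) (f g f' g' : Hom A B) (α : Cell f g) (β : Cell f' g') :
  α ≡ β -> f = f'.
Proof. intros E. exact (f_equal (fun x => fst (projT1 x)) E). Qed.

Lemma tot_cod (A B : C) (f g f' g' : Hom A B) (α : Cell f g) (β : Cell f' g') :
  α ≡ β -> g = g'.
Proof. intros E. exact (f_equal (fun x => snd (projT1 x)) E). Qed.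

Lemma eq2_tot (A B : C) (f g : Hom A B) (e : f = g) : eq2 e ≡ id2 f.
Proof. destruct e. reflexivity. Qed.

Lemma id2_tot (A B : C) (f g : Hom A B) (e : f = g) : id2 f ≡ id2 g.
Proof. destruct e. reflexivity. Qed.

Lemma lwhisk_tot (X A B : C) (k k' : Hom A B) (f g f' g' : Hom X A)
    (α : Cell f g) (β : Cell f' g') : k = k' -> α ≡ β -> k ◁ α ≡ k' ◁ β.
Proof.
intros [] E. revert f' g' β E.
apply (tot_ind (P := fun f' g' β => k ◁ α ≡ k ◁ β)). reflexivity.
Qed.

Lemma rwhisk_tot (X A B : C) (k k' : Hom X A) (f g f' g' : Hom A B)
    (α : Cell f g) (β : Cell f' g') : α ≡ β -> k = k' -> α ▷ k ≡ β ▷ k'.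
Proof.
intros E []. revert f' g' β E.
apply (tot_ind (P := fun f' g' β => α ▷ k ≡ β ▷ k)). reflexivity.
Qed.

Lemma lwhisk_totr (X A B : C) (k : Hom A B) (f g f' g' : Hom X A)
    (α : Cell f g) (β : Cell f' g') : α ≡ β -> k ◁ α ≡ k ◁ β.
Proof. now apply lwhisk_tot. Qed.

Lemma rwhisk_totl (X A B : C) (k : Hom X A) (f g f' g' : Hom A B)
    (α : Cell f g) (β : Cell f' g') : α ≡ β -> α ▷ k ≡ β ▷ k.
Proof. intros E. now apply rwhisk_tot. Qed.

Lemma pcomp_vcomp (A B : C) (f g h : Hom A B) (β : Cell g h) (α : Cell f g) (e : g = g) :
  pcomp β α e = β • α.
Proof.
rewrite (proof_irrelevance _ e eq_refl). unfold pcomp, eq2.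
now rewrite vcomp_idl.
Qed.

Lemma pcomp_tot (A B : C) (f g k h f' g' k' h' : Hom A B)
    (β : Cell k h) (α : Cell f g) (e : g = k)
    (β' : Cell k' h') (α' : Cell f' g') (e' : g' = k') :
  β ≡ β' -> α ≡ α' -> pcomp β α e ≡ pcomp β' α' e'.
Proof.
intros Eβ Eα. revert f' g' α' Eα e'. refine (tot_ind _). 
revert k' h' β' Eβ. refine (tot_ind _). intros e'.
now rewrite (proof_irrelevance _ e e').
Qed.

Lemma pcomp_tot_l (A B : C) (f g k h k' h' : Hom A B)
    (β : Cell k h) (α : Cell f g) (e : g = k) (β' : Cell k' h') (E : β ≡ β') :
  pcomp β α e ≡ pcomp β' α (eq_trans e (tot_dom E)).
Proof. now apply pcomp_tot. Qed.

Lemma pcomp_tot_r (A B : C) (f g k h f' g' : Hom A B)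
    (β : Cell k h) (α : Cell f g) (e : g = k) (α' : Cell f' g') (E : α ≡ α') :
  pcomp β α e ≡ pcomp β α' (eq_trans (eq_sym (tot_cod E)) e).
Proof. now apply pcomp_tot. Qed.

Lemma vcomp_pcomp (A B : C) (f g h : Hom A B) (β : Cell g h) (α : Cell f g) :
  β • α = pcomp β α eq_refl.
Proof. now rewrite pcomp_vcomp. Qed.

Lemma vcomp_tot (A B : C) (f g h f' g' h' : Hom A B)
    (β : Cell g h) (α : Cell f g) (β' : Cell g' h') (α' : Cell f' g') :
  β ≡ β' -> α ≡ α' -> β • α ≡ β' • α'.
Proof. rewrite !vcomp_pcomp. apply pcomp_tot. Qed.

Lemma pcomp_idl (A B : C) (f g k : Hom A B) (α : Cell f g) (e : g = k) :
  pcomp (id2 k) α e ≡ α.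
Proof. destruct e. now rewrite pcomp_vcomp, vcomp_idl. Qed.

Lemma pcomp_idr (A B : C) (f g k : Hom A B) (α : Cell f g) (e : k = f) :
  pcomp α (id2 k) e ≡ α.
Proof. destruct e. now rewrite pcomp_vcomp, vcomp_idr. Qed.

Lemma vcomp_eq2l (A B : C) (f g h : Hom A B) (α : Cell f g) (e : g = h) :
  eq2 e • α ≡ α.
Proof. destruct e; cbn. now rewrite vcomp_idl. Qed.

Lemma vcomp_eq2r (A B : C) (f g h : Hom A B) (α : Cell g h) (e : f = g) :
  α • eq2 e ≡ α.
Proof. destruct e; cbn. now rewrite vcomp_idr. Qed.

Lemma pcompA (A B : C) (f g g' h h' k : Hom A B)
    (γ : Cell h' k) (β : Cell g' h) (α : Cell f g) (e : g = g') (e' : h = h') :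
  pcomp (pcomp γ β e') α e = pcomp γ (pcomp β α e) e'.
Proof. destruct e, e'. rewrite !pcomp_vcomp. apply vcompA. Qed.

Lemma lwhisk_pcomp (X A B : C) (k : Hom A B) (f g g' h : Hom X A)
    (β : Cell g' h) (α : Cell f g) (e : g = g') :
  k ◁ pcomp β α e = pcomp (k ◁ β) (k ◁ α) (f_equal (comp1 k) e).
Proof. destruct e. cbn. rewrite !pcomp_vcomp. apply lwhisk_vcomp. Qed.

Lemma rwhisk_pcomp (X A B : C) (k : Hom X A) (f g g' h : Hom A B)
    (β : Cell g' h) (α : Cell f g) (e : g = g') :
  pcomp β α e ▷ k = pcomp (β ▷ k) (α ▷ k) (f_equal (fun x => comp1 x k) e).
Proof. destruct e. cbn. rewrite !pcomp_vcomp. apply rwhisk_vcomp. Qed.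

End Heterogeneous.

Lemma map2_tot (C D : TwoCatData) (F : PreFunctor C D) (A B : C) (f g f' g' : Hom A B)
    (α : Cell f g) (β : Cell f' g') : α ≡ β -> map2 F α ≡ map2 F β.
Proof.
intros E; exact (f_equal (fun x : {p : Hom A B * Hom A B & Cell (fst p) (snd p)} =>
  tot (map2 F (projT2 x))) E).
Qed.

Lemma tf_pcomp (C D : TwoCat) (F : TwoFunctor C D) (A B : C) (f g g' h : Hom A B)
    (β : Cell g' h) (α : Cell f g) (e : g = g') :
  map2 F (pcomp β α e) = pcomp (map2 F β) (map2 F α) (f_equal (map1 F) e).
Proof. destruct e. cbn. rewrite !pcomp_vcomp. apply tf_vcomp. Qed.

Ltac strict ::=
  cbn; rewrite ?tf_comp1, ?tf_id1, ?comp1A, ?comp1_idl, ?comp1_idr; reflexivity.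

(** * Constructions on pseudofunctors and 2-functors *)

Definition eq2_inv (C : TwoCat) (A B : C) (f g : Hom A B) (e : f = g) : InvCell f g.
Proof.
refine (MkInvCell (eq2 e) (eq2 (eq_sym e)) _ _);
  destruct e; apply vcomp_idl.
Defined.

Definition tf_id (C : TwoCat) : TwoFunctor C C.
Proof. now refine {| tf_map := pre_id C |}. Defined.

Definition tf_comp (C D E : TwoCat) (G : TwoFunctor D E) (F : TwoFunctor C D) :
  TwoFunctor C E.
Proof.
refine {| tf_map := pre_comp G F |}; cbn; intros.
- now rewrite !tf_id1.
- now rewrite !tf_comp1.
- now rewrite !tf_id2.
- now rewrite !tf_vcomp.
- exact (eq_trans (map2_tot G (tf_lwhisk F k α)) (tf_lwhisk G _ _)).
- exact (eq_trans (map2_tot G (tf_rwhisk F α k)) (tf_rwhisk G _ _)).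
Defined.

(* A 2-functor is a pseudofunctor with identity structure cells. *)
Definition pf_of (C D : TwoCat) (F : TwoFunctor C D) : PseudoFunctor C D.
Proof.
refine {| pf_map := F;
  pf_gamma := fun X Y Z g f => eq2_inv (tf_comp1 F g f);
  pf_iota := fun X => eq2_inv (tf_id1 F X) |}; cbn.
- apply tf_id2.
- apply tf_vcomp.
- intros; apply tot_inj.
  now rewrite vcomp_eq2l, vcomp_eq2r, tf_lwhisk.
- intros; apply tot_inj.
  now rewrite vcomp_eq2l, vcomp_eq2r, tf_rwhisk.
- intros W X Y Z h g f.
  transitivity (tot (id2 (map1 F h ∘ (map1 F g ∘ map1 F f)))); [ | symmetry ].
  + rewrite vcomp_eq2r.
    rewrite (lwhisk_tot (eq_refl (map1 F h)) (eq2_tot (tf_comp1 F g f))), lwhisk_id2.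
    now rewrite tf_comp1.
  + rewrite vcomp_eq2r.
    rewrite (rwhisk_tot (eq2_tot (tf_comp1 F h g)) (eq_refl (map1 F f))), rwhisk_id2.
    now rewrite tf_comp1, comp1A.
- intros X Y f. rewrite vcomp_eq2r.
  rewrite (rwhisk_tot (eq2_tot (tf_id1 F Y)) (eq_refl (map1 F f))), rwhisk_id2.
  now rewrite tf_id1, comp1_idl.
- intros X Y f. rewrite vcomp_eq2r.
  rewrite (lwhisk_tot (eq_refl (map1 F f)) (eq2_tot (tf_id1 F X))), lwhisk_id2.
  now rewrite tf_id1, comp1_idr.
Defined.

Definition vcomp_inv (C : TwoCat) (A B : C) (f g h : Hom A B)
    (β : InvCell g h) (α : InvCell f g) : InvCell f h.
Proof.
refine (MkInvCell (β • α) (inv α • inv β) _ _).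
- rewrite vcompA, <- (vcompA α), fwd_inv, vcomp_idl. apply fwd_inv.
- rewrite vcompA, <- (vcompA (inv β)), inv_fwd, vcomp_idl. apply inv_fwd.
Defined.

Definition map2_inv (C D : TwoCat) (F : PseudoFunctor C D) (A B : C) (f g : Hom A B)
    (α : InvCell f g) : InvCell (map1 F f) (map1 F g).
Proof.
refine (MkInvCell (map2 F α) (map2 F (inv α)) _ _); rewrite <- pf_vcomp.
- rewrite fwd_inv. apply pf_id2.
- rewrite inv_fwd. apply pf_id2.
Defined.

Definition pf_comp (C D E : TwoCat) (G : PseudoFunctor D E) (F : PseudoFunctor C D) :
  PseudoFunctor C E.
Proof.
refine {| pf_map := pre_comp G F;
  pf_gamma := fun X Y Z g f =>
    vcomp_inv (pf_gamma G (map1 F g) (map1 F f)) (map2_inv G (pf_gamma F g f));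
  pf_iota := fun X => vcomp_inv (pf_iota G (F X)) (map2_inv G (pf_iota F X)) |}; cbn.
- intros. now rewrite !pf_id2.
- intros. now rewrite !pf_vcomp.
- intros. rewrite vcompA, <- pf_vcomp, pf_gamma_natl, pf_vcomp, <- vcompA.
  now rewrite pf_gamma_natl, vcompA.
- intros. rewrite vcompA, <- pf_vcomp, pf_gamma_natr, pf_vcomp, <- vcompA.
  now rewrite pf_gamma_natr, vcompA.
- intros.
  rewrite lwhisk_vcomp, rwhisk_vcomp, !vcompA.
  rewrite <- (vcompA _ (pf_gamma G (map1 F h) _)), <- pf_gamma_natl.
  rewrite <- (vcompA _ (pf_gamma G _ (map1 F f))), <- pf_gamma_natr.
  rewrite !vcompA, <- !pf_vcomp, <- !vcompA.
  apply vcomp_tot; [ apply pf_gammaA | ].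
  apply map2_tot, pf_gammaA.
- intros X Y f. rewrite rwhisk_vcomp, vcompA, <- (vcompA _ (pf_gamma G _ _)).
  rewrite <- pf_gamma_natr, !vcompA, <- pf_vcomp, <- vcompA.
  etransitivity; [ apply vcomp_tot; [ apply pf_iotal | ] | ].
  + etransitivity; [ apply map2_tot, pf_iotal | ]. now rewrite pf_id2.
  + now rewrite vcomp_idl.
- intros X Y f. rewrite lwhisk_vcomp, vcompA, <- (vcompA _ (pf_gamma G _ _)).
  rewrite <- pf_gamma_natl, !vcompA, <- pf_vcomp, <- vcompA.
  etransitivity; [ apply vcomp_tot; [ apply pf_iotar | ] | ].
  + etransitivity; [ apply map2_tot, pf_iotar | ]. now rewrite pf_id2.
  + now rewrite vcomp_idl.
Defined.

(** * Colax natural transformations and modifications *)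

Record TransData (C D : TwoCat) (K K' : PreFunctor C D) : Type := MkTransData {
  tr1 :> forall A : C, Hom (K A) (K' A);
  tr2 : forall (A B : C) (f : Hom A B), Cell (tr1 B ∘ map1 K f) (map1 K' f ∘ tr1 A)
}.
Arguments tr1 {C D K K'} α A : rename.
Arguments tr2 {C D K K'} α {A B} f : rename.

Record ColaxTrans (C D : TwoCat) (K K' : PseudoFunctor C D) : Type := MkColaxTrans {
  ct_data :> TransData K K';
  ct_nat : forall (A B : C) (f g : Hom A B) (θ : Cell f g),
      tr2 ct_data g • (ct_data B ◁ map2 K θ) = (map2 K' θ ▷ ct_data A) • tr2 ct_data f;
  ct_unit : forall A : C,
      (pf_iota K' A ▷ ct_data A) • tr2 ct_data (id1 A) ≡ ct_data A ◁ pf_iota K A;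
  ct_comp : forall (X Y Z : C) (g : Hom Y Z) (f : Hom X Y),
      (pf_gamma K' g f ▷ ct_data X) • tr2 ct_data (g ∘ f) ≡
      (map1 K' g ◁ tr2 ct_data f) ⊙ (tr2 ct_data g ▷ map1 K f)
        ⊙ (ct_data Z ◁ pf_gamma K g f)
}.

Definition trans_id (C D : TwoCat) (K : PreFunctor C D) : TransData K K :=
  {| tr1 := fun A => id1 (K A);
     tr2 := fun A B f => id2 (map1 K f ∘ id1 (K A)) ⊙ id2 (id1 (K B) ∘ map1 K f) |}.

Definition trans_comp (C D : TwoCat) (K K' K'' : PreFunctor C D)
    (β : TransData K' K'') (α : TransData K K') : TransData K K'' :=
  {| tr1 := fun A => β A ∘ α A;
     tr2 := fun A B f =>
       id2 (map1 K'' f ∘ (β A ∘ α A)) ⊙ (tr2 β f ▷ α A) ⊙ (β B ◁ tr2 α f)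
         ⊙ id2 (β B ∘ α B ∘ map1 K f) |}.

(* [α F : KF => K'F] *)
Definition trans_pre (B C D : TwoCat) (K K' : PreFunctor C D) (α : TransData K K')
    (F : PreFunctor B C) : TransData (pre_comp K F) (pre_comp K' F) :=
  @MkTransData B D (pre_comp K F) (pre_comp K' F)
    (fun A => α (F A)) (fun A A' f => tr2 α (map1 F f)).

(* [F α : FK => FK'] *)
Definition trans_post (B C D : TwoCat) (F : PseudoFunctor C D) (K K' : PreFunctor B C)
    (α : TransData K K') : TransData (pre_comp F K) (pre_comp F K') :=
  @MkTransData B D (pre_comp F K) (pre_comp F K')
    (fun A => map1 F (α A))
    (fun A A' f => pf_gamma F (map1 K' f) (α A) • map2 F (tr2 α f)
                     • inv (pf_gamma F (α A') (map1 K f))).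

Record Modification (C D : TwoCat) (K K' : PreFunctor C D) (α β : TransData K K') :
    Type := MkModification {
  mod2 :> forall A : C, Cell (α A) (β A);
  mod_nat : forall (A B : C) (f : Hom A B),
      tr2 β f • (mod2 B ▷ map1 K f) = (map1 K' f ◁ mod2 A) • tr2 α f
}.

(** * Colax adjunctions *)

(* [Ψ] and [Φ] use that composition of [PreFunctor]s is definitionally
   associative and unital. *)
Record ColaxAdjunction (X Y : TwoCat) (F : PseudoFunctor X Y) (U : PseudoFunctor Y X) :
    Type := MkColaxAdjunction {
  ca_unit : ColaxTrans (pf_of (tf_id X)) (pf_comp U F);
  ca_counit : ColaxTrans (pf_comp F U) (pf_of (tf_id Y));
  ca_Psi : @Modification X Y F F
      (trans_comp (trans_pre ca_counit F) (trans_post F ca_unit)) (trans_id F);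
  ca_Phi : @Modification Y X U U
      (trans_id U) (trans_comp (trans_post U ca_counit) (trans_pre ca_unit U));
  ca_swallowtail_unit : forall A : X,
      let η := ca_unit in let ε := ca_counit in
      let UPsi : Cell (map1 U (ε (F A)) ∘ map1 U (map1 F (η A))) (id1 (U (F A))) :=
        pf_iota U (F A) • map2 U (ca_Psi A)
          • inv (pf_gamma U (ε (F A)) (map1 F (η A))) in
      id2 (η A) ⊙ (UPsi ▷ η A) ⊙ (map1 U (ε (F A)) ◁ tr2 η (η A))
        ⊙ (ca_Phi (F A) ▷ η A) ⊙ id2 (η A) = id2 (η A);
  ca_swallowtail_counit : forall B : Y,
      let η := ca_unit in let ε := ca_counit in
      let FPhi : Cell (id1 (F (U B))) (map1 F (map1 U (ε B)) ∘ map1 F (η (U B))) :=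
        pf_gamma F (map1 U (ε B)) (η (U B)) • map2 F (ca_Phi B)
          • inv (pf_iota F (U B)) in
      id2 (ε B) ⊙ (ε B ◁ ca_Psi (U B)) ⊙ (tr2 ε (ε B) ▷ map1 F (η (U B)))
        ⊙ (ε B ◁ FPhi) ⊙ id2 (ε B) = id2 (ε B)
}.

(** * Strict notions: 2-natural transformations, 2-adjunctions, 2-(co)monads *)

Record TwoNat (C D : TwoCat) (K K' : PreFunctor C D) : Type := MkTwoNat {
  tn1 :> forall A : C, Hom (K A) (K' A);
  tn_nat1 : forall (A B : C) (f : Hom A B), tn1 B ∘ map1 K f = map1 K' f ∘ tn1 A;
  tn_nat2 : forall (A B : C) (f g : Hom A B) (α : Cell f g),
      tn1 B ◁ map2 K α ≡ map2 K' α ▷ tn1 A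
}.

Record TwoAdjunction (C D : TwoCat) (F : TwoFunctor C D) (U : TwoFunctor D C) :
    Type := MkTwoAdjunction {
  ta_unit : TwoNat (tf_id C) (tf_comp U F);
  ta_counit : TwoNat (tf_comp F U) (tf_id D);
  ta_triangle_l : forall A : C, ta_counit (F A) ∘ map1 F (ta_unit A) = id1 (F A);
  ta_triangle_r : forall B : D, map1 U (ta_counit B) ∘ ta_unit (U B) = id1 (U B)
}.

Record TwoMonad (C : TwoCat) : Type := MkTwoMonad {
  tm_functor :> TwoFunctor C C;
  tm_mult : TwoNat (tf_comp tm_functor tm_functor) tm_functor;
  tm_unit : TwoNat (tf_id C) tm_functor;
  tm_unitl : forall A : C, tm_mult A ∘ tm_unit (tm_functor A) = id1 (tm_functor A);
  tm_unitr : forall A : C, tm_mult A ∘ map1 tm_functor (tm_unit A) = id1 (tm_functor A);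
  tm_multA : forall A : C,
      tm_mult A ∘ map1 tm_functor (tm_mult A) = tm_mult A ∘ tm_mult (tm_functor A)
}.
Arguments tm_mult {C} T : rename.
Arguments tm_unit {C} T : rename.

Record TwoComonad (C : TwoCat) : Type := MkTwoComonad {
  tc_functor :> TwoFunctor C C;
  tc_comult : TwoNat tc_functor (tf_comp tc_functor tc_functor);
  tc_counit : TwoNat tc_functor (tf_id C);
  tc_counitl : forall A : C, tc_counit (tc_functor A) ∘ tc_comult A = id1 (tc_functor A);
  tc_counitr : forall A : C,
      map1 tc_functor (tc_counit A) ∘ tc_comult A = id1 (tc_functor A);
  tc_comultA : forall A : C,
      map1 tc_functor (tc_comult A) ∘ tc_comult A = tc_comult (tc_functor A) ∘ tc_comult A
}.
Arguments tc_comult {C} Q : rename.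
Arguments tc_counit {C} Q : rename.

Definition generated_comult (C D : TwoCat) (F : TwoFunctor C D) (U : TwoFunctor D C)
    (adj : TwoAdjunction F U) :
  TwoNat (tf_comp F U) (tf_comp (tf_comp F U) (tf_comp F U)).
Proof.
refine (@MkTwoNat D D (tf_comp F U) (tf_comp (tf_comp F U) (tf_comp F U))
  (fun B => map1 F (ta_unit adj (U B))) _ _); cbn.
- intros A B f. rewrite <- !tf_comp1. f_equal. apply (tn_nat1 (ta_unit adj)).
- intros A B f g α. rewrite <- tf_lwhisk, <- tf_rwhisk. apply map2_tot.
  apply (tn_nat2 (ta_unit adj)).
Defined.

Definition generated_comonad (C D : TwoCat) (F : TwoFunctor C D) (U : TwoFunctor D C)
    (adj : TwoAdjunction F U) : TwoComonad D.
Proof.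
refine {| tc_functor := tf_comp F U;
  tc_comult := generated_comult adj; tc_counit := ta_counit adj |}; cbn.
- intros B. apply ta_triangle_l.
- intros B. rewrite <- tf_comp1. etransitivity; [ | apply tf_id1 ].
  f_equal. apply ta_triangle_r.
- intros B. rewrite <- !tf_comp1. f_equal.
  symmetry. apply (tn_nat1 (ta_unit adj)).
Defined.

Definition LaxIdempotent (C : TwoCat) (Q : TwoComonad C) : Prop :=
  forall A : C, exists adj : InternalAdjunction (tc_comult Q A) (tc_counit Q (Q A)),
    adj_unit adj ≡ id2 (id1 (Q A)).

Record PseudoCoalgebra (C : TwoCat) (Q : TwoComonad C) (A : C) : Type :=
    MkPseudoCoalgebra {
  pc1 : Hom A (Q A);
  pc_counit : InvCell (tc_counit Q A ∘ pc1) (id1 A);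
  pc_comult : InvCell (map1 Q pc1 ∘ pc1) (tc_comult Q A ∘ pc1);
  pc_assoc :
    pcomp (tc_comult Q (Q A) ◁ pc_comult) (map1 Q (map1 Q pc1) ◁ pc_comult)
      ltac:(rewrite <- !comp1A; f_equal; symmetry; apply (tn_nat1 (tc_comult Q))) ≡
    pcomp (map1 Q (tc_comult Q A) ◁ pc_comult) (map2 Q pc_comult ▷ pc1)
      ltac:(rewrite tf_comp1; apply comp1A);
  pc_unitl : tc_counit Q (Q A) ◁ pc_comult ≡ pc1 ◁ pc_counit;
  pc_unitr : map1 Q (tc_counit Q A) ◁ pc_comult ≡ map2 Q pc_counit ▷ pc1
}.

Definition NormalCoalgebra (C : TwoCat) (Q : TwoComonad C) (A : C)
    (x : PseudoCoalgebra Q A) : Prop :=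
  pc_counit x ≡ id2 (id1 A).
(** * Algebras of a 2-monad *)

Section Algebras.
Context {K : TwoCat} (T : TwoMonad K).

Record Alg : Type := MkAlg {
  alg0 : K;
  alg1 : Hom (T alg0) alg0;
  alg_unit : alg1 ∘ tm_unit T alg0 = id1 alg0;
  alg_mult : alg1 ∘ tm_mult T alg0 = alg1 ∘ map1 T alg1
}.

Record LaxMor (A B : Alg) : Type := MkLaxMor {
  lm1 : Hom (alg0 A) (alg0 B);
  lm2 : Cell (alg1 B ∘ map1 T lm1) (lm1 ∘ alg1 A);
  lm_unit : lm2 ▷ tm_unit T (alg0 A) ≡ id2 lm1;
  lm_mult :
    lm2 ▷ tm_mult T (alg0 A) ≡
    (lm2 ▷ map1 T (alg1 A)) ⊙ (alg1 B ◁ map2 T lm2)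
}.

Definition LaxCell (A B : Alg) (f g : LaxMor A B) : Type :=
  {α : Cell (lm1 f) (lm1 g) |
    lm2 g • (alg1 B ◁ map2 T α) = (α ▷ alg1 A) • lm2 f}.

Definition lax_id2 (A : Alg) : Cell (alg1 A ∘ map1 T (id1 (alg0 A))) (id1 (alg0 A) ∘ alg1 A) :=
  id2 (id1 (alg0 A) ∘ alg1 A) ⊙ id2 (alg1 A ∘ map1 T (id1 (alg0 A))).

Definition lax_comp2 (A B C : Alg) (g : LaxMor B C) (f : LaxMor A B) :
    Cell (alg1 C ∘ map1 T (lm1 g ∘ lm1 f)) (lm1 g ∘ lm1 f ∘ alg1 A) :=
  id2 (lm1 g ∘ lm1 f ∘ alg1 A) ⊙ (lm1 g ◁ lm2 f) ⊙ (lm2 g ▷ map1 T (lm1 f))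
    ⊙ id2 (alg1 C ∘ map1 T (lm1 g ∘ lm1 f)).

Lemma lax_id2_tot (A : Alg) : lax_id2 A ≡ id2 (alg1 A).
Proof.
unfold lax_id2. rewrite pcomp_idl. apply id2_tot. now rewrite tf_id1, comp1_idr.
Qed.

Lemma lax_comp2_tot (A B C : Alg) (g : LaxMor B C) (f : LaxMor A B) :
  lax_comp2 g f ≡
  pcomp (lm1 g ◁ lm2 f) (lm2 g ▷ map1 T (lm1 f)) (comp1A (lm1 g) (alg1 B) (map1 T (lm1 f))).
Proof.
unfold lax_comp2. rewrite pcomp_idr. apply pcomp_tot; [ | reflexivity ].
apply pcomp_idl.
Qed.

Definition lax_id (A : Alg) : LaxMor A A.
Proof.
refine (@MkLaxMor A A (id1 (alg0 A)) (lax_id2 A) _ _).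
- rewrite (rwhisk_totl _ (lax_id2_tot A)), rwhisk_id2.
  now rewrite alg_unit.
- rewrite (rwhisk_totl _ (lax_id2_tot A)), rwhisk_id2. symmetry.
  assert (H : lax_id2 A ▷ map1 T (alg1 A) ≡ id2 (alg1 A ∘ map1 T (alg1 A))).
  { now rewrite (rwhisk_totl _ (lax_id2_tot A)), rwhisk_id2. }
  rewrite (pcomp_tot_l _ _ H), pcomp_idl.
  rewrite (lwhisk_totr _ (map2_tot T (lax_id2_tot A))), tf_id2, lwhisk_id2.
  apply id2_tot. symmetry. apply alg_mult.
Defined.

Definition lax_comp (A B C : Alg) (g : LaxMor B C) (f : LaxMor A B) : LaxMor A C.
Proof.
refine (@MkLaxMor A C (lm1 g ∘ lm1 f) (lax_comp2 g f) _ _).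
- rewrite (rwhisk_totl _ (lax_comp2_tot g f)), rwhisk_pcomp.
  assert (H1 : (lm1 g ◁ lm2 f) ▷ tm_unit T (alg0 A) ≡ id2 (lm1 g ∘ lm1 f)).
  { rewrite whiskA, (lwhisk_totr _ (lm_unit f)). now rewrite lwhisk_id2. }
  rewrite (pcomp_tot_l _ _ H1), pcomp_idl, <- rwhisk_comp1.
  rewrite <- (rwhisk_tot eq_refl (tn_nat1 (tm_unit T) (lm1 f))); cbn.
  rewrite rwhisk_comp1, (rwhisk_totl _ (lm_unit g)). now rewrite rwhisk_id2.
- set (a := alg1 A). set (b := alg1 B). set (c := alg1 C).
  set (f1 := lm1 f) in *. set (g1 := lm1 g) in *.
  set (f2 := lm2 f : Cell (b ∘ map1 T f1) (f1 ∘ a)).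
  set (g2 := lm2 g : Cell (c ∘ map1 T g1) (g1 ∘ b)).
  assert (HX : (g1 ◁ f2) ▷ tm_mult T (alg0 A) ≡
    pcomp (g1 ◁ (f2 ▷ map1 T a)) (g1 ◁ (b ◁ map2 T f2)) ltac:(strict)).
  { rewrite whiskA, (lwhisk_totr _ (lm_mult f)), lwhisk_pcomp. now apply pcomp_tot. }
  assert (HY : (g2 ▷ map1 T f1) ▷ tm_mult T (alg0 A) ≡
    pcomp (g2 ▷ map1 T b ▷ map1 T (map1 T f1)) ((c ◁ map2 T g2) ▷ map1 T (map1 T f1))
      ltac:(strict)).
  { rewrite <- rwhisk_comp1.
    rewrite <- (rwhisk_tot eq_refl (tn_nat1 (tm_mult T) f1)); cbn.
    rewrite rwhisk_comp1, (rwhisk_totl _ (lm_mult g)), rwhisk_pcomp.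
    now apply pcomp_tot. }
  assert (HU : lax_comp2 g f ▷ map1 T a ≡
    pcomp (g1 ◁ (f2 ▷ map1 T a)) (g2 ▷ map1 T (f1 ∘ a)) ltac:(strict)).
  { rewrite (rwhisk_totl _ (lax_comp2_tot g f)), rwhisk_pcomp.
    apply pcomp_tot; [ apply whiskA | ].
    rewrite <- rwhisk_comp1. apply rwhisk_tot; [ reflexivity | ].
    symmetry. apply tf_comp1. }
  assert (HV : c ◁ map2 T (lax_comp2 g f) ≡
    pcomp (c ∘ map1 T g1 ◁ map2 T f2) ((c ◁ map2 T g2) ▷ map1 T (map1 T f1))
      ltac:(strict)).
  { rewrite (lwhisk_totr _ (map2_tot T (lax_comp2_tot g f))).
    rewrite tf_pcomp, lwhisk_pcomp.
    apply pcomp_tot.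
    - rewrite (lwhisk_totr _ (tf_lwhisk T _ _)). now rewrite <- lwhisk_comp1.
    - rewrite (lwhisk_totr _ (tf_rwhisk T _ _)). now rewrite <- whiskA. }
  assert (HM : pcomp (g1 ∘ b ◁ map2 T f2) (g2 ▷ map1 T (b ∘ map1 T f1)) eq_refl ≡
    pcomp (g2 ▷ map1 T (f1 ∘ a)) (c ∘ map1 T g1 ◁ map2 T f2) eq_refl).
  { rewrite !pcomp_vcomp. now rewrite interchange. }
  rewrite (rwhisk_totl _ (lax_comp2_tot g f)), rwhisk_pcomp.
  rewrite (pcomp_tot_l _ _ HX), (pcomp_tot_r _ _ HY), pcompA.
  symmetry.
  rewrite (pcomp_tot_l _ _ HU), (pcomp_tot_r _ _ HV), pcompA.
  apply pcomp_tot; [ reflexivity | ].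
  rewrite <- !pcompA.
  apply pcomp_tot; [ | reflexivity ].
  etransitivity; [ etransitivity; [ | symmetry; exact HM ]; now apply pcomp_tot | ].
  apply pcomp_tot; [ now rewrite <- lwhisk_comp1 | ].
  rewrite <- rwhisk_comp1. apply rwhisk_tot; [ reflexivity | ].
  now rewrite tf_comp1.
Defined.

Lemma lax_mor_eq (A B : Alg) (f g : LaxMor A B) :
  lm1 f = lm1 g -> lm2 f ≡ lm2 g -> f = g.
Proof.
destruct f as [f1 f2 fu fm], g as [g1 g2 gu gm]; cbn. intros e. destruct e.
intros E. apply tot_inj in E. destruct E.
now rewrite (proof_irrelevance _ fu gu), (proof_irrelevance _ fm gm).
Qed.

Lemma lax_cell_eq (A B : Alg) (f g : LaxMor A B) (α β : LaxCell f g) :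
  proj1_sig α = proj1_sig β -> α = β.
Proof. destruct α, β; cbn. apply subset_eq_compat. Qed.

Definition lax_cell_id2 (A B : Alg) (f : LaxMor A B) : LaxCell f f.
Proof.
exists (id2 (lm1 f)).
now rewrite tf_id2, lwhisk_id2, rwhisk_id2, vcomp_idl, vcomp_idr.
Defined.

Definition lax_cell_vcomp (A B : Alg) (f g h : LaxMor A B)
    (β : LaxCell g h) (α : LaxCell f g) : LaxCell f h.
Proof.
exists (proj1_sig β • proj1_sig α).
rewrite tf_vcomp, lwhisk_vcomp, rwhisk_vcomp, <- vcompA, (proj2_sig β).
now rewrite !vcompA, (proj2_sig α).
Defined.

Definition lax_cell_lwhisk (A B C : Alg) (k : LaxMor B C) (f g : LaxMor A B)
    (α : LaxCell f g) : LaxCell (lax_comp k f) (lax_comp k g).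
Proof.
exists (lm1 k ◁ proj1_sig α).
apply tot_inj. cbn.
set (c := alg1 C). set (k2 := lm2 k : Cell (c ∘ map1 T (lm1 k)) (lm1 k ∘ alg1 B)).
transitivity (tot (pcomp (lm1 k ◁ (lm2 g • (alg1 B ◁ map2 T (proj1_sig α))))
  (k2 ▷ map1 T (lm1 f)) (comp1A _ _ _))); [ | rewrite (proj2_sig α) ].
- rewrite vcomp_pcomp.
  rewrite (pcomp_tot_l _ _ (lax_comp2_tot k g)).
  assert (H : c ◁ map2 T (lm1 k ◁ proj1_sig α) ≡ c ∘ map1 T (lm1 k) ◁ map2 T (proj1_sig α)).
  { rewrite (lwhisk_totr _ (tf_lwhisk T _ _)). now rewrite <- lwhisk_comp1. }
  rewrite (pcomp_tot_r _ _ H), pcompA.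
  rewrite lwhisk_vcomp, vcomp_pcomp, pcompA.
  apply pcomp_tot; [ reflexivity | ].
  transitivity (tot ((k2 ▷ map1 T (lm1 g)) • (c ∘ map1 T (lm1 k) ◁ map2 T (proj1_sig α)))).
  + rewrite vcomp_pcomp. now apply pcomp_tot.
  + rewrite interchange, vcomp_pcomp. apply pcomp_tot; [ apply lwhisk_comp1 | reflexivity ].
- symmetry. rewrite vcomp_pcomp.
  rewrite (pcomp_tot_r _ _ (lax_comp2_tot k f)).
  rewrite lwhisk_vcomp, vcomp_pcomp, <- pcompA.
  apply pcomp_tot; [ | reflexivity ].
  apply pcomp_tot; [ apply whiskA | reflexivity ].
Defined.

Definition lax_cell_rwhisk (A B C : Alg) (g h : LaxMor B C) (α : LaxCell g h)
    (f : LaxMor A B) : LaxCell (lax_comp g f) (lax_comp h f).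
Proof.
exists (proj1_sig α ▷ lm1 f).
apply tot_inj. cbn.
set (c := alg1 C).
set (g2 := lm2 g : Cell (c ∘ map1 T (lm1 g)) (lm1 g ∘ alg1 B)).
set (h2 := lm2 h : Cell (c ∘ map1 T (lm1 h)) (lm1 h ∘ alg1 B)).
transitivity (tot (pcomp (lm1 h ◁ lm2 f)
  ((h2 • (c ◁ map2 T (proj1_sig α))) ▷ map1 T (lm1 f)) (comp1A _ _ _)));
  [ | unfold h2, c; rewrite (proj2_sig α); fold g2 ].
- rewrite vcomp_pcomp.
  rewrite (pcomp_tot_l _ _ (lax_comp2_tot h f)), pcompA.
  apply pcomp_tot; [ reflexivity | ].
  rewrite rwhisk_vcomp, vcomp_pcomp. apply pcomp_tot; [ reflexivity | ].
  rewrite (lwhisk_totr _ (tf_rwhisk T _ _)). now rewrite <- whiskA.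
- rewrite rwhisk_vcomp, (vcomp_pcomp (_ ▷ _)), <- pcompA. symmetry.
  rewrite vcomp_pcomp.
  rewrite (pcomp_tot_r _ _ (lax_comp2_tot g f)), <- pcompA.
  apply pcomp_tot; [ | reflexivity ].
  transitivity (tot ((lm1 h ◁ lm2 f) • (proj1_sig α ▷ (alg1 B ∘ map1 T (lm1 f))))).
  + rewrite <- interchange, vcomp_pcomp. apply pcomp_tot; [ | reflexivity ].
    symmetry. apply rwhisk_comp1.
  + rewrite vcomp_pcomp. apply pcomp_tot; [ reflexivity | ]. apply rwhisk_comp1.
Defined.

Definition AlgLData : TwoCatData :=
  {| Ob := Alg;
     Hom := LaxMor;
     Cell := LaxCell;
     id1 := lax_id;
     comp1 := lax_comp;
     id2 := lax_cell_id2;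
     vcomp := lax_cell_vcomp;
     lwhisk := lax_cell_lwhisk;
     rwhisk := lax_cell_rwhisk |}.

Lemma lax_tot (A B : AlgLData) (f g f' g' : Hom A B) (α : Cell f g) (β : Cell f' g') :
  f = f' -> g = g' -> proj1_sig α ≡ proj1_sig β -> α ≡ β.
Proof.
intros e e' E. subst f' g'. apply tot_inj in E. now rewrite (lax_cell_eq E).
Qed.

Lemma lax_compA (A B C D : Alg) (h : LaxMor C D) (g : LaxMor B C) (f : LaxMor A B) :
  lax_comp (lax_comp h g) f = lax_comp h (lax_comp g f).
Proof.
apply lax_mor_eq; cbn; [ apply comp1A | ].
etransitivity; [ exact (lax_comp2_tot (lax_comp h g) f) | symmetry ].
etransitivity; [ exact (lax_comp2_tot h (lax_comp g f)) | symmetry; cbn ].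
assert (H1 : lax_comp2 h g ▷ map1 T (lm1 f) ≡
  pcomp (lm1 h ◁ (lm2 g ▷ map1 T (lm1 f))) (lm2 h ▷ map1 T (lm1 g) ▷ map1 T (lm1 f))
    ltac:(strict)).
{ rewrite (rwhisk_totl _ (lax_comp2_tot h g)), rwhisk_pcomp.
  apply pcomp_tot; [ apply whiskA | reflexivity ]. }
assert (H2 : lm1 h ◁ lax_comp2 g f ≡
  pcomp (lm1 h ◁ (lm1 g ◁ lm2 f)) (lm1 h ◁ (lm2 g ▷ map1 T (lm1 f))) ltac:(strict)).
{ rewrite (lwhisk_totr _ (lax_comp2_tot g f)), lwhisk_pcomp. now apply pcomp_tot. }
rewrite (pcomp_tot_r _ _ H1), (pcomp_tot_l _ _ H2), pcompA.
apply pcomp_tot; [ apply lwhisk_comp1 | ].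
apply pcomp_tot; [ reflexivity | ].
rewrite <- rwhisk_comp1. apply rwhisk_tot; [ reflexivity | ].
symmetry. apply tf_comp1.
Qed.

Lemma lax_comp_idl (A B : Alg) (f : LaxMor A B) : lax_comp (lax_id B) f = f.
Proof.
apply lax_mor_eq; cbn; [ apply comp1_idl | ].
etransitivity; [ exact (lax_comp2_tot (lax_id B) f) | cbn ].
assert (H : lax_id2 B ▷ map1 T (lm1 f) ≡ id2 (alg1 B ∘ map1 T (lm1 f))).
{ now rewrite (rwhisk_totl _ (lax_id2_tot B)), rwhisk_id2. }
rewrite (pcomp_tot_r _ _ H), pcomp_idr. apply lwhisk_id1.
Qed.

Lemma lax_comp_idr (A B : Alg) (f : LaxMor A B) : lax_comp f (lax_id A) = f.
Proof.
apply lax_mor_eq; cbn; [ apply comp1_idr | ].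
etransitivity; [ exact (lax_comp2_tot f (lax_id A)) | cbn ].
assert (H : lm1 f ◁ lax_id2 A ≡ id2 (lm1 f ∘ alg1 A)).
{ now rewrite (lwhisk_totr _ (lax_id2_tot A)), lwhisk_id2. }
rewrite (pcomp_tot_l _ _ H), pcomp_idl.
rewrite (rwhisk_tot eq_refl (tf_id1 T (alg0 A))). apply rwhisk_id1.
Qed.

(* The 2-category of strict algebras, lax morphisms and algebra 2-cells. *)
Definition AlgL : TwoCat.
Proof.
refine {| tc_data := AlgLData;
  comp1A := lax_compA; comp1_idl := lax_comp_idl; comp1_idr := lax_comp_idr |}; intros.
- apply lax_cell_eq, vcompA.
- apply lax_cell_eq, vcomp_idl.
- apply lax_cell_eq, vcomp_idr.
- apply lax_cell_eq, lwhisk_id2.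
- apply lax_cell_eq, rwhisk_id2.
- apply lax_cell_eq, lwhisk_vcomp.
- apply lax_cell_eq, rwhisk_vcomp.
- apply lax_cell_eq, interchange.
- apply lax_tot; [ apply lax_compA | apply lax_compA | apply lwhisk_comp1 ].
- apply lax_tot; [ symmetry; apply lax_compA | symmetry; apply lax_compA | ].
  apply rwhisk_comp1.
- apply lax_tot; [ apply lax_compA | apply lax_compA | apply whiskA ].
- apply lax_tot; [ apply lax_comp_idl | apply lax_comp_idl | apply lwhisk_id1 ].
- apply lax_tot; [ apply lax_comp_idr | apply lax_comp_idr | apply rwhisk_id1 ].
Defined.

(* Strict morphisms are the lax morphisms whose structure 2-cell is an identity. *)
Definition IsStrict (A B : AlgL) (f : Hom A B) : Prop :=
  lm2 f ≡ id2 (lm1 f ∘ alg1 A).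

Lemma strict_id (A : AlgL) : IsStrict (id1 A).
Proof. unfold IsStrict; cbn. rewrite lax_id2_tot. apply id2_tot. now rewrite comp1_idl. Qed.

Lemma strict_comp (A B C : AlgL) (g : Hom B C) (f : Hom A B) :
  IsStrict g -> IsStrict f -> IsStrict (g ∘ f).
Proof.
unfold IsStrict; cbn. intros Hg Hf. rewrite (lax_comp2_tot g f).
assert (H1 : lm1 g ◁ lm2 f ≡ id2 (lm1 g ∘ (lm1 f ∘ alg1 A))).
{ now rewrite (lwhisk_totr _ Hf), lwhisk_id2. }
assert (H2 : lm2 g ▷ map1 T (lm1 f) ≡ id2 (lm1 g ∘ alg1 B ∘ map1 T (lm1 f))).
{ now rewrite (rwhisk_totl _ Hg), rwhisk_id2. }
rewrite (pcomp_tot_l _ _ H1), pcomp_idl, H2. apply id2_tot.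
rewrite !comp1A. f_equal. exact (tot_dom Hf).
Qed.

End Algebras.

(** * Wide locally full sub-2-categories *)

Section Wide.
Context {C : TwoCat} (P : forall A B : C, Hom A B -> Prop).
Context (P_id : forall A : C, P (id1 A))
  (P_comp : forall (X Y Z : C) (g : Hom Y Z) (f : Hom X Y), P g -> P f -> P (g ∘ f)).

Definition WideData : TwoCatData :=
  {| Ob := C;
     Hom := fun A B => {f : Hom A B | P f};
     Cell := fun A B f g => Cell (proj1_sig f) (proj1_sig g);
     id1 := fun A => exist _ (id1 A) (P_id A);
     comp1 := fun X Y Z g f =>
       exist _ (proj1_sig g ∘ proj1_sig f) (P_comp (proj2_sig g) (proj2_sig f));
     id2 := fun A B f => id2 (proj1_sig f);
     vcomp := fun A B f g h β α => β • α;
     lwhisk := fun X Y Z k f g α => proj1_sig k ◁ α;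
     rwhisk := fun X Y Z g h α f => α ▷ proj1_sig f |}.

Lemma wide_eq (A B : WideData) (f g : Hom A B) : proj1_sig f = proj1_sig g -> f = g.
Proof. destruct f, g; cbn. apply subset_eq_compat. Qed.

Lemma wide_tot (A B : WideData) (f g f' g' : Hom A B) (α : Cell f g) (β : Cell f' g') :
  @tot C A B (proj1_sig f) (proj1_sig g) α = @tot C A B (proj1_sig f') (proj1_sig g') β ->
  α ≡ β.
Proof.
intros E. assert (e := wide_eq (tot_dom E)). assert (e' := wide_eq (tot_cod E)).
subst f' g'. now apply tot_inj in E; subst.
Qed.

Definition Wide : TwoCat.
Proof.
refine {| tc_data := WideData |}; intros; cbn in *.
- apply wide_eq, comp1A.
- apply wide_eq, comp1_idl.
- apply wide_eq, comp1_idr.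
- apply vcompA.
- apply vcomp_idl.
- apply vcomp_idr.
- apply lwhisk_id2.
- apply rwhisk_id2.
- apply lwhisk_vcomp.
- apply rwhisk_vcomp.
- apply interchange.
- apply wide_tot, lwhisk_comp1.
- apply wide_tot, rwhisk_comp1.
- apply wide_tot, whiskA.
- apply wide_tot, lwhisk_id1.
- apply wide_tot, rwhisk_id1.
Defined.

Definition wide_incl : TwoFunctor Wide C.
Proof.
now refine {| tf_map := @MkPreFunctor Wide C (fun A => A)
  (fun A B f => proj1_sig f) (fun A B f g α => α) |}.
Defined.

End Wide.

Definition AlgS (K : TwoCat) (T : TwoMonad K) : TwoCat :=
  Wide (strict_id (T := T)) (strict_comp (T := T)).

Definition AlgJ (K : TwoCat) (T : TwoMonad K) : TwoFunctor (AlgS T) (AlgL T) :=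
  wide_incl (strict_id (T := T)) (strict_comp (T := T)).

(** * Property L and lax-flexible algebras *)

(* The left 2-adjoint is determined up to isomorphism only, so it is part of the data. *)
Record PropertyL (K : TwoCat) (T : TwoMonad K) : Type := MkPropertyL {
  pl_left : TwoFunctor (AlgL T) (AlgS T);
  pl_adj : TwoAdjunction pl_left (AlgJ T);
  pl_lax_idempotent : LaxIdempotent (generated_comonad pl_adj)
}.

Definition lax_classifier (K : TwoCat) (T : TwoMonad K) (L : PropertyL T) :
    TwoComonad (AlgS T) :=
  generated_comonad (pl_adj L).

Definition LaxFlexible (K : TwoCat) (T : TwoMonad K) (L : PropertyL T) (A : AlgS T) : Prop :=
  exists x : PseudoCoalgebra (lax_classifier L) A, NormalCoalgebra x.

(* Main.v *)
Require Import Defs.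
From Stdlib Require Import IndefiniteDescription.

Set Implicit Arguments.
Unset Strict Implicit.
Unset Printing Implicit Defensive.

(** Write [Q] for the left 2-adjoint of the inclusion [J], with unit [p] and
    counit [q], and [η], [ε] for the unit and counit of [H ⊣ GJ].

    Lax idempotency provides 2-cells [Qp_A ∘ q_QA ⇒ 1].  Restricting them along
    [p] and composing with [Qq] gives [u : 1 ⇒ p_A ∘ q_A] among lax morphisms, and
    this [u] exhibits [q_A ⊣ p_A] with identity counit ([reflection_unit]), so a
    2-cell [h ⇒ k ∘ q_A] is determined by its restriction along [p_A]
    ([restrict_unit_inj]).  While [q] is natural for strict morphisms only, for a
    lax [f : A → B] the naturality square of [p] has a mate
    [q_B ∘ Qf ⇒ f ∘ q_A], which is the only such 2-cell restricting along [p_A] to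
    the identity of [f].  Uniqueness makes these mates functorial in [f], natural
    in 2-cells and trivial when [f] is strict: they form a colax natural
    transformation [JQ ⇒ 1].

    The 1-cells [ε_QA ∘ HGp_A] form a 2-natural transformation [c : HG ⇒ Q]
    ([classify]) such that [q_A ∘ c_A = ε_A].  Hence restricting the mates along
    [c] makes [ε] colax natural for lax morphisms ([colax_counit]), while [η]
    stays strictly natural.  The triangle equations of [H ⊣ GJ] hold on the nose,
    so both modifications [Ψ] and [Φ] may be identities.  Everything left to check
    is that certain 2-cells are identities; besides formal ones there are only two
    cases: the counit 2-cell at a strict morphism ([counit_strict]) and the image
    under [G] of the counit 2-cell at a lax morphism, restricted along [η]
    ([counit_restrict_unit]).  The second holds because [Gc_A ∘ η_GA = Gp_A] and
    the mates restrict along [p] to identities.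

    For the last claim, [c_HX ∘ Hη_X : HX → QHX] is the transpose of
    [Gp_HX ∘ η_X].  Transposing the coalgebra equations and using the naturality
    of [p] for lax morphisms shows that it is a strict coalgebra structure, which
    is in particular a normal pseudo-coalgebra structure. *)

(** * Identity 2-cells up to equality of boundaries *)

(** 1-cells that agree only propositionally are joined by 2-cells such as [eq2 e].
    The predicate below covers them all.  It is stable under every operation on
    2-cells, and two such 2-cells with the same boundary are equal, which replaces
    each coherence computation between structure cells by a syntactic check. *)
Definition IdCell (C : TwoCat) (A B : C) (f g : Hom A B) (α : Cell f g) : Prop :=
  α ≡ id2 f.

Section IdCells.
Context {C : TwoCat}.

Lemma idcell_dom_cod (A B : C) (f g : Hom A B) (α : Cell f g) : IdCell α -> f = g.
Proof. intros E. symmetry. exact (tot_cod E). Qed.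

Lemma idcell_tot (A B : C) (f g f' g' : Hom A B) (α : Cell f g) (β : Cell f' g') :
  IdCell α -> IdCell β -> f = f' -> α ≡ β.
Proof.
intros Hα Hβ e. etransitivity; [ exact Hα | ].
etransitivity; [ exact (id2_tot e) | symmetry; exact Hβ ].
Qed.

Lemma idcell_eq (A B : C) (f g : Hom A B) (α β : Cell f g) :
  IdCell α -> IdCell β -> α = β.
Proof. intros. apply tot_inj. now apply idcell_tot. Qed.

Lemma tot_idcell (A B : C) (f g f' g' : Hom A B) (α : Cell f g) (β : Cell f' g') :
  α ≡ β -> IdCell β -> IdCell α.
Proof.
intros E H. unfold IdCell. rewrite E, (H : _ = _). apply id2_tot.
symmetry. exact (tot_dom E).
Qed.

Lemma idcell_id2 (A B : C) (f : Hom A B) : IdCell (id2 f).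
Proof. reflexivity. Qed.

Lemma idcell_eq2 (A B : C) (f g : Hom A B) (e : f = g) : IdCell (eq2 e).
Proof. apply eq2_tot. Qed.

Lemma pcomp_idcell_l (A B : C) (f g g' h : Hom A B) (β : Cell g' h) (α : Cell f g)
    (e : g = g') : IdCell β -> pcomp β α e ≡ α.
Proof. intros H. rewrite (pcomp_tot_l _ _ H). apply pcomp_idl. Qed.

Lemma pcomp_idcell_r (A B : C) (f g g' h : Hom A B) (β : Cell g' h) (α : Cell f g)
    (e : g = g') : IdCell α -> pcomp β α e ≡ β.
Proof. intros H. rewrite (pcomp_tot_r _ _ H). apply pcomp_idr. Qed.

Lemma vcomp_idcell_l (A B : C) (f g h : Hom A B) (β : Cell g h) (α : Cell f g) :
  IdCell β -> β • α ≡ α.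
Proof. rewrite vcomp_pcomp. apply pcomp_idcell_l. Qed.

Lemma vcomp_idcell_r (A B : C) (f g h : Hom A B) (β : Cell g h) (α : Cell f g) :
  IdCell α -> β • α ≡ β.
Proof. rewrite vcomp_pcomp. apply pcomp_idcell_r. Qed.

Lemma idcell_pcomp (A B : C) (f g g' h : Hom A B) (β : Cell g' h) (α : Cell f g)
    (e : g = g') : IdCell β -> IdCell α -> IdCell (pcomp β α e).
Proof. intros Hβ Hα. exact (tot_idcell (pcomp_idcell_l α e Hβ) Hα). Qed.

Lemma idcell_vcomp (A B : C) (f g h : Hom A B) (β : Cell g h) (α : Cell f g) :
  IdCell β -> IdCell α -> IdCell (β • α).
Proof. rewrite vcomp_pcomp. apply idcell_pcomp. Qed.

Lemma idcell_lwhisk (X A B : C) (k : Hom A B) (f g : Hom X A) (α : Cell f g) :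
  IdCell α -> IdCell (k ◁ α).
Proof. intros H. unfold IdCell. now rewrite (lwhisk_totr k H), lwhisk_id2. Qed.

Lemma idcell_rwhisk (X A B : C) (k : Hom X A) (f g : Hom A B) (α : Cell f g) :
  IdCell α -> IdCell (α ▷ k).
Proof. intros H. unfold IdCell. now rewrite (rwhisk_totl k H), rwhisk_id2. Qed.

Lemma idcell_inv (A B : C) (f g : Hom A B) (α : InvCell f g) :
  IdCell α -> IdCell (inv α).
Proof.
intros H. refine (tot_idcell (β := inv α • α) _ _).
- symmetry. now apply vcomp_idcell_r.
- rewrite inv_fwd. apply idcell_id2.
Qed.

(** Transport of a 2-cell along equalities of its boundary. *)
Definition cast (A B : C) (f g f' g' : Hom A B) (α : Cell f g) (e : f' = f) (e' : g = g') :
  Cell f' g' := eq2 e' • α • eq2 e.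

Lemma cast_tot (A B : C) (f g f' g' : Hom A B) (α : Cell f g) (e : f' = f) (e' : g = g') :
  cast α e e' ≡ α.
Proof. unfold cast. now rewrite vcomp_eq2r, vcomp_eq2l. Qed.

End IdCells.

Lemma idcell_map2 (C D : TwoCat) (F : PseudoFunctor C D) (A B : C) (f g : Hom A B)
    (α : Cell f g) : IdCell α -> IdCell (map2 F α).
Proof. intros H. unfold IdCell. now rewrite (map2_tot F H), pf_id2. Qed.

(** * Strict pseudofunctors *)

(** Unlike being of the form [pf_of F], this is closed under [pf_comp]: the structure
    cells of a composite are composites of [eq2]s and not themselves [eq2]s. *)
Definition StrictPf (C D : TwoCat) (F : PseudoFunctor C D) : Prop :=
  (forall (X Y Z : C) (g : Hom Y Z) (f : Hom X Y), IdCell (pf_gamma F g f)) /\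
  (forall X : C, IdCell (pf_iota F X)).

Lemma strict_pf_of (C D : TwoCat) (F : TwoFunctor C D) : StrictPf (pf_of F).
Proof. split; intros; apply idcell_eq2. Qed.

Lemma strict_pf_comp (C D E : TwoCat) (G : PseudoFunctor D E) (F : PseudoFunctor C D) :
  StrictPf G -> StrictPf F -> StrictPf (pf_comp G F).
Proof.
intros [Gγ Gι] [Fγ Fι]. split; intros; cbn; apply idcell_vcomp; auto;
  apply idcell_map2; auto.
Qed.

(** Between strict pseudofunctors the structure cells drop out of the unit and
    composition axioms. *)
Definition strict_colax (C D : TwoCat) (K K' : PseudoFunctor C D)
    (SK : StrictPf K) (SK' : StrictPf K') (α : TransData K K')
    (nat : forall (A B : C) (f g : Hom A B) (θ : Cell f g),
      tr2 α g • (α B ◁ map2 K θ) = (map2 K' θ ▷ α A) • tr2 α f)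
    (unit : forall A : C, IdCell (tr2 α (id1 A)))
    (comp : forall (X Y Z : C) (g : Hom Y Z) (f : Hom X Y),
      tr2 α (g ∘ f) ≡ (map1 K' g ◁ tr2 α f) ⊙ (tr2 α g ▷ map1 K f)) :
  ColaxTrans K K'.
Proof.
refine (@MkColaxTrans C D K K' α nat _ _).
- intros A. apply idcell_tot; [ | apply idcell_lwhisk, (proj2 SK) | reflexivity ].
  apply idcell_vcomp; [ apply idcell_rwhisk, (proj2 SK') | apply unit ].
- intros X Y Z g f.
  rewrite (vcomp_idcell_l _ (idcell_rwhisk (α X) (proj1 SK' X Y Z g f))), comp.
  symmetry. etransitivity; [ apply pcomp_idcell_r; apply idcell_lwhisk, (proj1 SK) | ].
  now apply pcomp_tot.
Defined.

Definition colax_of_twonat (C D : TwoCat) (K K' : PseudoFunctor C D)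
    (SK : StrictPf K) (SK' : StrictPf K') (α : TwoNat K K') : ColaxTrans K K'.
Proof.
refine (@strict_colax C D K K' SK SK'
  (@MkTransData C D K K' (fun A => α A) (fun A B f => eq2 (tn_nat1 α f))) _ _ _); cbn.
- intros A B f g θ. apply tot_inj.
  rewrite vcomp_eq2l, vcomp_eq2r. apply tn_nat2.
- intros A. apply idcell_eq2.
- intros X Y Z g f. apply idcell_tot; [ apply idcell_eq2 | | ].
  + apply idcell_pcomp; [ apply idcell_lwhisk | apply idcell_rwhisk ];
      apply idcell_eq2.
  + rewrite comp1A. f_equal. exact (idcell_dom_cod (proj1 SK X Y Z g f)).
Defined.

(** * Composites of 2-natural transformations *)

Definition twonat_comp (C D : TwoCat) (K K' K'' : PreFunctor C D)
    (β : TwoNat K' K'') (α : TwoNat K K') : TwoNat K K''.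
Proof.
refine (@MkTwoNat C D K K'' (fun A => β A ∘ α A) _ _).
- intros A B f. now rewrite comp1A, tn_nat1, <- comp1A, tn_nat1, comp1A.
- intros A B f g θ.
  rewrite lwhisk_comp1, (lwhisk_totr _ (tn_nat2 α θ)), <- whiskA.
  now rewrite (rwhisk_totl _ (tn_nat2 β θ)), <- rwhisk_comp1.
Defined.

Definition twonat_pre (B C D : TwoCat) (K K' : PreFunctor C D) (α : TwoNat K K')
    (F : PreFunctor B C) : TwoNat (pre_comp K F) (pre_comp K' F) :=
  @MkTwoNat B D (pre_comp K F) (pre_comp K' F) (fun A => α (F A))
    (fun A B f => tn_nat1 α (map1 F f)) (fun A B f g θ => tn_nat2 α (map2 F θ)).

Definition twonat_post (B C D : TwoCat) (F : TwoFunctor C D) (K K' : PreFunctor B C)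
    (α : TwoNat K K') : TwoNat (pre_comp F K) (pre_comp F K').
Proof.
refine (@MkTwoNat B D (pre_comp F K) (pre_comp F K') (fun A => map1 F (α A)) _ _); cbn.
- intros X Y f. now rewrite <- !tf_comp1, tn_nat1.
- intros X Y f g θ. rewrite <- tf_lwhisk, <- tf_rwhisk. apply map2_tot, tn_nat2.
Defined.

Lemma transpose_inj (C D : TwoCat) (F : TwoFunctor C D) (U : TwoFunctor D C)
    (adj : TwoAdjunction F U) (A : C) (B : D) (f g : Hom (F A) B) :
  map1 U f ∘ ta_unit adj A = map1 U g ∘ ta_unit adj A -> f = g.
Proof.
assert (T : forall h : Hom (F A) B,
  ta_counit adj B ∘ map1 F (map1 U h ∘ ta_unit adj A) = h).
{ intros h. rewrite tf_comp1, <- comp1A.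
  etransitivity; [ apply (f_equal (fun x => x ∘ _)), (tn_nat1 (ta_counit adj) h) | ].
  rewrite comp1A. etransitivity; [ apply f_equal, ta_triangle_l | apply comp1_idr ]. }
intros E. now rewrite <- (T f), E, T.
Qed.

(** * Colax naturality of a pointwise left adjoint *)

(** The hypotheses say that [q A ⊣ p A] with unit [u A] and identity counit, where
    only [p] is assumed natural. *)
Section Reflection.
Context {C : TwoCat} (R : TwoFunctor C C) (p : TwoNat (tf_id C) R)
  (q : forall A : C, Hom (R A) A) (qp : forall A : C, q A ∘ p A = id1 A)
  (u : forall A : C, Cell (id1 (R A)) (p A ∘ q A))
  (up : forall A : C, IdCell (u A ▷ p A)) (qu : forall A : C, IdCell (q A ◁ u A)).

(** Precomposition turns [q A ⊣ p A] into an adjunction of hom-categories, so that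
    2-cells [h ⇒ k ∘ q A] correspond to 2-cells [h ∘ p A ⇒ k]. *)
Lemma restrict_unit_inj (A X : C) (h : Hom (R A) X) (k : Hom A X) (α β : Cell h (k ∘ q A)) :
  α ▷ p A ≡ β ▷ p A -> α = β.
Proof.
assert (T : forall γ : Cell h (k ∘ q A), γ ≡ pcomp (γ ▷ p A ▷ q A) (h ◁ u A)
  (eq_sym (comp1A _ _ _))).
{ intros γ. symmetry.
  (* Interchange of [γ] with [u A]; the other order of composition is [γ], since
     [q A ◁ u A] is an identity. *)
  transitivity (tot (pcomp (γ ▷ (p A ∘ q A)) (h ◁ u A) eq_refl)).
  { apply pcomp_tot; [ symmetry; apply rwhisk_comp1 | reflexivity ]. }
  rewrite pcomp_vcomp, interchange.
  rewrite vcomp_idcell_l, rwhisk_id1; [ reflexivity | ].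
  refine (tot_idcell (lwhisk_comp1 _ _ _) _). apply idcell_lwhisk, qu. }
intros E. apply tot_inj. rewrite (T α), (T β).
apply pcomp_tot; [ now apply rwhisk_totl | reflexivity ].
Qed.

Lemma mate_dom (A B : C) (f : Hom A B) : q B ∘ map1 R f = q B ∘ map1 R f ∘ id1 (R A).
Proof. now rewrite comp1_idr. Qed.

Lemma mate_dom_restrict (A B : C) (f : Hom A B) : q B ∘ map1 R f ∘ p A = f.
Proof.
rewrite comp1A. etransitivity; [ apply f_equal, eq_sym, (tn_nat1 p f) | ].
transitivity (q B ∘ p B ∘ f); [ symmetry; exact (comp1A (q B) (p B) f) | ].
now rewrite qp, comp1_idl.
Qed.

Lemma mate_cod (A B : C) (f : Hom A B) :
  q B ∘ map1 R f ∘ (p A ∘ q A) = f ∘ q A.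
Proof. now rewrite <- comp1A, mate_dom_restrict. Qed.

(** The mate of the naturality square [Rf ∘ p A = p B ∘ f] under [q ⊣ p]. *)
Definition mate (A B : C) (f : Hom A B) : Cell (q B ∘ map1 R f) (f ∘ q A) :=
  cast ((q B ∘ map1 R f) ◁ u A) (mate_dom f) (mate_cod f).

Lemma mate_restrict (A B : C) (f : Hom A B) : IdCell (mate f ▷ p A).
Proof.
refine (tot_idcell (rwhisk_totl _ (cast_tot _ _ _)) _).
refine (tot_idcell (whiskA _ _ _) _). apply idcell_lwhisk, up.
Qed.

Lemma mate_nat (A B : C) (f g : Hom A B) (α : Cell f g) :
  mate g • (q B ◁ map2 R α) = (α ▷ q A) • mate f.
Proof.
apply restrict_unit_inj. rewrite !rwhisk_vcomp.
rewrite (vcomp_idcell_l _ (mate_restrict g)), (vcomp_idcell_r _ (mate_restrict f)).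
rewrite <- rwhisk_comp1, (rwhisk_tot (eq_refl (tot α)) (qp A)), rwhisk_id1.
rewrite whiskA, <- (lwhisk_totr _ (tn_nat2 p α)).
transitivity (tot (q B ∘ p B ◁ α)); [ symmetry; exact (lwhisk_comp1 (q B) (p B) α) | ].
now rewrite (lwhisk_tot (qp B) (eq_refl (tot α))), lwhisk_id1.
Qed.

(** Where [q] is natural in the strict sense, the identity also restricts to the
    identity, hence is the mate. *)
Lemma mate_idcell (A B : C) (f : Hom A B) :
  q B ∘ map1 R f = f ∘ q A -> IdCell (mate f).
Proof.
intros e. refine (tot_idcell (β := eq2 e) _ (idcell_eq2 e)).
f_equal. apply restrict_unit_inj. apply idcell_tot; [ apply mate_restrict | | reflexivity ].
apply idcell_rwhisk, idcell_eq2.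
Qed.

(** Both sides restrict along [p X] to the identity; on the right, the mate of [g]
    meets [p Y] because [Rf ∘ p X = p Y ∘ f]. *)
Lemma mate_comp (X Y Z : C) (g : Hom Y Z) (f : Hom X Y) :
  mate (g ∘ f) ≡ (g ◁ mate f) ⊙ (mate g ▷ map1 R f).
Proof.
set (ψ := pcomp (g ◁ mate f) (mate g ▷ map1 R f) _).
assert (e : q Z ∘ map1 R (g ∘ f) = q Z ∘ map1 R g ∘ map1 R f)
  by now rewrite tf_comp1, comp1A.
assert (e' : g ∘ (f ∘ q X) = g ∘ f ∘ q X) by now rewrite comp1A.
transitivity (tot (cast ψ e e')); [ | apply cast_tot ].
f_equal. apply restrict_unit_inj. apply idcell_tot; [ apply mate_restrict | | reflexivity ].
refine (tot_idcell (rwhisk_totl _ (cast_tot _ _ _)) _).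
unfold ψ. rewrite rwhisk_pcomp. apply idcell_pcomp.
- refine (tot_idcell (whiskA _ _ _) _). apply idcell_lwhisk, mate_restrict.
- refine (tot_idcell (eq_sym (rwhisk_comp1 _ _ _)) _).
  refine (tot_idcell (rwhisk_tot eq_refl (eq_sym (tn_nat1 p f))) _).
  refine (tot_idcell (rwhisk_comp1 _ _ _) _). apply idcell_rwhisk, mate_restrict.
Qed.

End Reflection.

(** * Lax idempotency as an adjunction between counit and unit *)

(** Of the algebra 2-categories only this is used: the strict morphisms form a
    wide, locally full sub-2-category. *)
Section Induced.
Context {C : TwoCat} (P : forall A B : C, Hom A B -> Prop).
Context (P_id : forall A : C, P (id1 A))
  (P_comp : forall (X Y Z : C) (g : Hom Y Z) (f : Hom X Y), P g -> P f -> P (g ∘ f)).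
Notation S := (Wide P_id P_comp).
Notation J := (wide_incl P_id P_comp).
Context (Q : TwoFunctor C S) (Qadj : TwoAdjunction Q J).

Notation p := (ta_unit Qadj).
Definition classifier_counit (A : C) : @Hom C (Q A) A := proj1_sig (ta_counit Qadj A).
Notation q := classifier_counit.

Lemma classifier_counit_unit (A : C) : q A ∘ p A = id1 A.
Proof. exact (ta_triangle_r Qadj A). Qed.

(** With [λ : δ ∘ q ⇒ 1] the counit of [δ ⊣ q] at [QA], the 2-cell [u] is
    [Qq ◁ (λ ▷ p)]: its domain is [Qq ∘ Qp = 1] as [q ∘ p = 1], and its codomain is
    [Qq ∘ p = p ∘ q] by naturality of [p].  The two triangle equations of [δ ⊣ q]
    become those of [q ⊣ p], since [p_QA ∘ p_A = δ_A ∘ p_A] and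
    [q_A ∘ Qq_A = q_A ∘ q_QA]. *)
Lemma reflection_unit (LI : LaxIdempotent (generated_comonad Qadj)) (A : C) :
  exists u : @Cell C (Q A) (Q A) (id1 _) (p A ∘ q A),
    IdCell (u ▷ p A) /\ IdCell (q A ◁ u).
Proof.
destruct (LI A) as [a Ha].
assert (Hδ := adj_triangle_l a). assert (Hq := adj_triangle_r a).
rewrite (pcomp_idcell_r _ _ (idcell_lwhisk _ Ha)) in Hδ.
rewrite (pcomp_idcell_r _ _ (idcell_rwhisk _ Ha)) in Hq.
apply (map2_tot J) in Hδ, Hq. cbn in Hδ, Hq.
set (δ := proj1_sig (map1 Q (p A)) : @Hom C (Q A) (Q (Q A))).
set (Qq := proj1_sig (map1 Q (q A)) : @Hom C (Q (Q A)) (Q A)).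
pose (λ := adj_counit a : @Cell C (Q (Q A)) (Q (Q A)) (δ ∘ q (Q A)) (id1 _)).
change (λ ▷ δ ≡ id2 δ) in Hδ.
change (q (Q A) ◁ λ ≡ id2 (q (Q A))) in Hq.
assert (e : id1 (Q A : C) = Qq ∘ (δ ∘ q (Q A) ∘ p (Q A))).
{ rewrite comp1A.
  etransitivity; [ | apply f_equal, f_equal, eq_sym, (classifier_counit_unit (Q A)) ].
  rewrite comp1_idr. unfold Qq, δ. symmetry.
  etransitivity; [ exact (f_equal (@proj1_sig _ _) (eq_sym (tf_comp1 Q (q A) (p A)))) | ].
  rewrite classifier_counit_unit. now rewrite tf_id1. }
assert (e' : Qq ∘ (id1 _ ∘ p (Q A)) = p A ∘ q A).
{ rewrite comp1_idl. exact (eq_sym (tn_nat1 p (q A))). }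
exists (cast (Qq ◁ (λ ▷ p (Q A))) e e'). split.
- refine (tot_idcell (rwhisk_totl _ (cast_tot _ _ _)) _).
  refine (tot_idcell (whiskA _ _ _) _). apply idcell_lwhisk.
  refine (tot_idcell (eq_sym (rwhisk_comp1 _ _ _)) _).
  refine (tot_idcell (rwhisk_tot eq_refl (tn_nat1 p (p A))) _).
  refine (tot_idcell (rwhisk_comp1 λ δ (p A)) _). apply idcell_rwhisk.
  exact (tot_idcell Hδ (idcell_id2 _)).
- refine (tot_idcell (lwhisk_totr _ (cast_tot _ _ _)) _).
  refine (tot_idcell (eq_sym (lwhisk_comp1 _ _ _)) _).
  assert (n : q A ∘ Qq = q A ∘ q (Q A)).
  { exact (f_equal (@proj1_sig _ _) (tn_nat1 (ta_counit Qadj) (ta_counit Qadj A))). }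
  refine (tot_idcell (lwhisk_tot n eq_refl) _).
  refine (tot_idcell (lwhisk_comp1 _ _ _) _). apply idcell_lwhisk.
  refine (tot_idcell (eq_sym (whiskA _ _ _)) _). apply idcell_rwhisk.
  exact (tot_idcell Hq (idcell_id2 _)).
Qed.

(** * The comparison with the classifier *)

Context (L : TwoCat) (G : TwoFunctor C L) (H : TwoFunctor L S)
  (adj : TwoAdjunction H (tf_comp G J)).

(** The canonical comparison of the comonad of [H ⊣ GJ] with that of [Q ⊣ J],
    extended to be natural for all 1-cells of [C]; its components are
    [ε_QA ∘ HGp_A]. *)
Definition classify : TwoNat (tf_comp H G) Q :=
  twonat_comp (twonat_pre (ta_counit adj) Q) (twonat_post (tf_comp H G) p).

(** That is, [classify A] is the transpose of [G p_A]. *)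
Lemma classify_unit (A : C) :
  map1 G (proj1_sig (classify A)) ∘ ta_unit adj (G A) = map1 G (p A).
Proof.
cbn. rewrite tf_comp1, comp1A.
etransitivity; [ apply f_equal, eq_sym, (tn_nat1 (ta_unit adj) (map1 G (p A))) | ].
cbn. rewrite <- comp1A.
etransitivity; [ exact (f_equal (fun x => x ∘ _) (ta_triangle_r adj (Q A))) | ].
apply comp1_idl.
Qed.

Lemma classify_counit (A : C) :
  q A ∘ proj1_sig (classify A) = proj1_sig (ta_counit adj A).
Proof.
cbn. rewrite <- comp1A.
etransitivity; [ apply (f_equal (fun x => x ∘ _)),
  (f_equal (@proj1_sig _ _)
    (eq_sym (tn_nat1 (ta_counit adj) (ta_counit Qadj A)))) | ].
cbn. rewrite comp1A.
etransitivity; [ apply f_equal | apply comp1_idr ].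
etransitivity; [ exact (f_equal (@proj1_sig _ _)
  (eq_sym (tf_comp1 (tf_comp H G) (q A) (p A)))) | ].
rewrite classifier_counit_unit. now rewrite tf_id1.
Qed.

(** * The colax adjunction *)

Section ColaxAdjunction.
Context (u : forall A : C, @Cell C (Q A) (Q A) (id1 _) (p A ∘ q A))
  (up : forall A : C, IdCell (u A ▷ p A)) (qu : forall A : C, IdCell (q A ◁ u A)).

Notation F := (pf_of (tf_comp J H)).
Notation U := (pf_of G).

Notation θ := (@mate C (tf_comp J Q) p q classifier_counit_unit u).
Notation c := (twonat_post J classify).

(** The boundary of a mate restricted along [c] is that of a counit 2-cell because
   [q ∘ c] is the counit of [H ⊣ GJ]. *)
Lemma counit2_dom (A B : C) (f : Hom A B) :
  proj1_sig (ta_counit adj B) ∘ map1 (pf_comp F U) f = q B ∘ proj1_sig (map1 Q f) ∘ c A.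
Proof.
rewrite <- classify_counit, !comp1A. apply f_equal. exact (tn_nat1 c f).
Qed.

Lemma counit2_cod (A B : C) (f : Hom A B) :
  f ∘ q A ∘ c A = f ∘ proj1_sig (ta_counit adj A).
Proof. rewrite comp1A. apply f_equal, classify_counit. Qed.

Definition counit_data : TransData (pf_comp F U) (pf_of (tf_id C)) :=
  @MkTransData C C (pf_comp F U) (pf_of (tf_id C))
    (fun A => proj1_sig (ta_counit adj A))
    (fun A B f => cast (θ f ▷ c A) (counit2_dom f) (counit2_cod f)).

Lemma counit_data2_mate (A B : C) (f : Hom A B) : tr2 counit_data f ≡ θ f ▷ c A.
Proof. apply cast_tot. Qed.

Lemma counit_strict (A B : S) (f : Hom A B) : IdCell (tr2 counit_data (proj1_sig f)).
Proof.
refine (tot_idcell (counit_data2_mate _) _). apply idcell_rwhisk, mate_idcell; trivial.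
exact (f_equal (@proj1_sig _ _) (tn_nat1 (ta_counit Qadj) f)).
Qed.

(** Restricting along [η_GA] after applying [G] turns restriction along [c_A] into
    restriction along [p_A], where the mate is an identity.  This is what makes the
    identities a modification [Φ]. *)
Lemma counit_restrict_unit (A B : C) (f : Hom A B) :
  IdCell (map2 G (tr2 counit_data f) ▷ ta_unit adj (G A)).
Proof.
refine (tot_idcell (rwhisk_totl _ (map2_tot G (counit_data2_mate f))) _).
refine (tot_idcell (rwhisk_totl _ (tf_rwhisk G _ _)) _).
refine (tot_idcell (eq_sym (rwhisk_comp1 _ _ _)) _).
refine (tot_idcell (rwhisk_tot eq_refl (classify_unit A)) _).
refine (tot_idcell (eq_sym (tf_rwhisk G _ _)) _).
apply (@idcell_map2 _ _ (pf_of G)).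
exact (@mate_restrict C (tf_comp J Q) p q classifier_counit_unit u up A B f).
Qed.

Definition colax_counit : ColaxTrans (pf_comp F U) (pf_of (tf_id C)).
Proof.
refine (@strict_colax C C _ _ _ _ counit_data _ _ _).
- apply strict_pf_comp; apply strict_pf_of.
- apply strict_pf_of.
- intros A B f g α. apply tot_inj.
  transitivity (tot ((θ g ▷ c A) • ((q B ◁ map2 (tf_comp J Q) α) ▷ c A))).
  + apply vcomp_tot; [ apply counit_data2_mate | ].
    rewrite whiskA.
    rewrite <- (lwhisk_totr _ (tn_nat2 c α)).
    rewrite <- lwhisk_comp1. apply lwhisk_tot; [ | reflexivity ].
    symmetry. apply classify_counit.
  + rewrite <- rwhisk_vcomp.
    etransitivity; [ exact (f_equal (fun x => tot (x ▷ c A))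
      (@mate_nat C (tf_comp J Q) p q classifier_counit_unit u up qu A B f g α)) | ].
    rewrite rwhisk_vcomp.
    apply vcomp_tot; [ | symmetry; apply counit_data2_mate ].
    rewrite <- rwhisk_comp1. apply rwhisk_tot; [ reflexivity | apply classify_counit ].
- intros A. exact (counit_strict (id1 (A : S))).
- intros X Y Z g f.
  etransitivity; [ apply counit_data2_mate | ].
  etransitivity; [ apply rwhisk_totl, mate_comp; trivial | ].
  rewrite rwhisk_pcomp. apply pcomp_tot.
  + rewrite whiskA. apply lwhisk_totr. symmetry. apply counit_data2_mate.
  + rewrite <- rwhisk_comp1, <- (rwhisk_tot eq_refl (tn_nat1 c f)), rwhisk_comp1.
    apply rwhisk_totl. symmetry. apply counit_data2_mate.
Defined.

Definition colax_unit : ColaxTrans (pf_of (tf_id L)) (pf_comp U F).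
Proof.
refine (@colax_of_twonat L L (pf_of (tf_id L)) (pf_comp U F) _ _ (ta_unit adj)).
- apply strict_pf_of.
- apply strict_pf_comp; apply strict_pf_of.
Defined.

Ltac idcells :=
  repeat first
    [ apply idcell_id2 | apply idcell_eq2
    | apply (strict_pf_of (tf_comp J H)) | apply (strict_pf_of G)
    | apply idcell_pcomp | apply idcell_vcomp | apply idcell_lwhisk
    | apply idcell_inv ].

Lemma triangle_l_incl (X : L) :
  proj1_sig (ta_counit adj (H X)) ∘ proj1_sig (map1 H (ta_unit adj X)) = id1 (H X : C).
Proof. exact (f_equal (@proj1_sig _ _) (ta_triangle_l adj X)). Qed.

Lemma triangle_r_incl (A : C) :
  id1 (G A) = map1 G (proj1_sig (ta_counit adj A)) ∘ ta_unit adj (G A).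
Proof. symmetry. exact (ta_triangle_r adj A). Qed.

Definition Psi : @Modification L C F F
  (trans_comp (trans_pre colax_counit F) (trans_post F colax_unit)) (trans_id F).
Proof.
refine (@MkModification L C F F
  (trans_comp (trans_pre colax_counit F) (trans_post F colax_unit)) (trans_id F)
  (fun X => eq2 (triangle_l_incl X)) _).
intros X Y f. apply idcell_eq.
- apply idcell_vcomp; [ apply idcell_pcomp; apply idcell_id2 | ].
  apply idcell_rwhisk, idcell_eq2.
- apply idcell_vcomp; [ apply idcell_lwhisk, idcell_eq2 | ].
  apply idcell_pcomp; [ apply idcell_pcomp; [ apply idcell_pcomp | ] | ].
  + apply idcell_id2.
  + apply idcell_rwhisk. exact (counit_strict (map1 H f)).
  + apply idcell_lwhisk. idcells. exact (idcell_map2 F (idcell_eq2 _)).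
  + apply idcell_id2.
Defined.

Definition Phi : @Modification C L U U
  (trans_id U) (trans_comp (trans_post U colax_counit) (trans_pre colax_unit U)).
Proof.
refine (@MkModification C L U U
  (trans_id U) (trans_comp (trans_post U colax_counit) (trans_pre colax_unit U))
  (fun A => eq2 (triangle_r_incl A)) _).
intros A B f. apply idcell_eq.
- apply idcell_vcomp; [ | apply idcell_rwhisk, idcell_eq2 ].
  apply idcell_pcomp; [ apply idcell_pcomp; [ apply idcell_pcomp | ] | ].
  + apply idcell_id2.
  + cbn -[pf_of]. rewrite !rwhisk_vcomp. apply idcell_vcomp; [ apply idcell_vcomp | ].
    * apply idcell_rwhisk, (strict_pf_of G).
    * apply counit_restrict_unit.
    * apply idcell_rwhisk, idcell_inv, (strict_pf_of G).
  + apply idcell_lwhisk, idcell_eq2.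
  + apply idcell_id2.
- apply idcell_vcomp; [ apply idcell_lwhisk, idcell_eq2 | ].
  apply idcell_pcomp; apply idcell_id2.
Defined.

Definition induced_colax_adjunction : ColaxAdjunction F U.
Proof.
refine (@MkColaxAdjunction L C F U colax_unit colax_counit Psi Phi _ _); cbv zeta.
- intros X. apply idcell_eq; [ | apply idcell_id2 ].
  apply idcell_pcomp; [ apply idcell_pcomp; [ apply idcell_pcomp;
    [ apply idcell_pcomp | ] | ] | ].
  + apply idcell_id2.
  + apply idcell_rwhisk. idcells. exact (idcell_map2 U (idcell_eq2 _)).
  + apply idcell_lwhisk, idcell_eq2.
  + apply idcell_rwhisk, idcell_eq2.
  + apply idcell_id2.
- intros A. apply idcell_eq; [ | apply idcell_id2 ].
  apply idcell_pcomp; [ apply idcell_pcomp; [ apply idcell_pcomp;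
    [ apply idcell_pcomp | ] | ] | ].
  + apply idcell_id2.
  + apply idcell_lwhisk, idcell_eq2.
  + apply idcell_rwhisk. exact (counit_strict (ta_counit adj A)).
  + apply idcell_lwhisk. idcells. exact (idcell_map2 F (idcell_eq2 _)).
  + apply idcell_id2.
Defined.

End ColaxAdjunction.

(** * The coalgebra structure *)

(** By [classify_unit] this is the transpose of [G p ∘ η]. *)
Definition coalg (X : L) : @Hom S (H X) (Q (H X)) :=
  classify (H X) ∘ map1 H (ta_unit adj X).

Lemma coalg_transpose (X : L) :
  map1 G (proj1_sig (coalg X)) ∘ ta_unit adj X = map1 G (p (H X)) ∘ ta_unit adj X.
Proof.
etransitivity; [ exact (f_equal (fun x => x ∘ _)
  (tf_comp1 (tf_comp G J) (classify (H X)) (map1 H (ta_unit adj X)))) | ].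
rewrite comp1A.
etransitivity; [ apply f_equal, eq_sym, (tn_nat1 (ta_unit adj) (ta_unit adj X)) | ].
etransitivity; [ apply eq_sym, comp1A | ].
exact (f_equal (fun x => x ∘ _) (classify_unit (H X))).
Qed.

Lemma coalg_counit (X : L) : ta_counit Qadj (H X) ∘ coalg X = id1 (H X).
Proof.
apply wide_eq. unfold coalg. cbn -[classify]. rewrite <- comp1A.
etransitivity; [ exact (f_equal (fun x => x ∘ _) (classify_counit (H X))) | ].
apply triangle_l_incl.
Qed.

(** The transposes of [Qy ∘ coalg X], for [y] the coalgebra and for [y := p], are
    [G p ∘ G y ∘ η] by naturality of [p] at [y]; [coalg_transpose] identifies
    them. *)
Lemma coalg_comult (X : L) :
  map1 Q (proj1_sig (coalg X)) ∘ coalg X = map1 Q (p (H X)) ∘ coalg X.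
Proof.
apply (transpose_inj (adj := adj)).
assert (T : forall y : @Hom C (H X) (Q (H X)),
  map1 (tf_comp G J) (map1 Q y ∘ coalg X) ∘ ta_unit adj X =
  map1 G (p (Q (H X))) ∘ (map1 G y ∘ ta_unit adj X)).
{ intros y.
  etransitivity; [ exact (f_equal (fun x => x ∘ _)
    (tf_comp1 (tf_comp G J) (map1 Q y) (coalg X))) | ].
  rewrite comp1A.
  etransitivity; [ apply f_equal, coalg_transpose | ].
  rewrite <- !comp1A. apply (f_equal (fun x => x ∘ _)).
  cbn. rewrite <- !tf_comp1. apply f_equal. exact (eq_sym (tn_nat1 p y)). }
rewrite !T. apply f_equal, coalg_transpose.
Qed.

End Induced.

Lemma normal_of_strict (C : TwoCat) (Q : TwoComonad C) (A : C) (x : Hom A (Q A)) :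
  tc_counit Q A ∘ x = id1 A -> map1 Q x ∘ x = tc_comult Q A ∘ x ->
  exists y : PseudoCoalgebra Q A, NormalCoalgebra y.
Proof.
intros e e'.
unshelve eexists (@MkPseudoCoalgebra C Q A x (eq2_inv e) (eq2_inv e') _ _ _).
- apply idcell_tot.
  + apply idcell_pcomp; apply idcell_lwhisk, idcell_eq2.
  + apply idcell_pcomp; [ apply idcell_lwhisk, idcell_eq2 | ].
    apply idcell_rwhisk, (idcell_map2 (pf_of Q)), idcell_eq2.
  + rewrite tf_comp1, !comp1A. apply f_equal. now rewrite e'.
- apply idcell_tot; [ apply idcell_lwhisk, idcell_eq2 .. | ].
  rewrite e', <- comp1A, tc_counitl, comp1_idl. now rewrite e, comp1_idr.
- apply idcell_tot; [ apply idcell_lwhisk, idcell_eq2 | | ].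
  + apply idcell_rwhisk, (idcell_map2 (pf_of Q)), idcell_eq2.
  + now rewrite <- comp1A, <- tf_comp1.
- unfold NormalCoalgebra; cbn. rewrite eq2_tot. now apply id2_tot.
Qed.

Theorem theorem5p8 (K : TwoCat) (T : TwoMonad K) (propL : PropertyL T)
    (L : TwoCat) (G : TwoFunctor (AlgL T) L) (H : TwoFunctor L (AlgS T))
    (adj : TwoAdjunction H (tf_comp G (AlgJ T))) :
  inhabited (ColaxAdjunction (pf_of (tf_comp (AlgJ T) H)) (pf_of G)) /\
  (forall X : L, LaxFlexible propL (H X)).
Proof.
split.
- (* The units exist only propositionally, one algebra at a time; choice makes them
     a family. *)
  pose (u A := constructive_indefinite_description _
    (reflection_unit (pl_lax_idempotent propL) A)).
  constructor.
  exact (induced_colax_adjunction (u := fun A => proj1_sig (u A)) adj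
    (fun A => proj1 (proj2_sig (u A))) (fun A => proj2 (proj2_sig (u A)))).
- intros X. apply (normal_of_strict (Q := lax_classifier propL) (A := H X)
    (x := coalg (pl_adj propL) adj X)).
  + apply coalg_counit.
  + apply coalg_comult.
Qed.
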